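(* Suppose that $J$ is positive-definite and $J^{-1}$ is a trace class operator. Then $$\mathfrak{W}(z)=w(0)+z\sum_{n=1}^{\infty}w_n(0)\,Q_n(z),$$ and the series converges locally uniformly on $\mathbb{C}$.
   Context: $(\boldsymbol e_n)_{n\ge0}$ is the standard basis of $\ell^2(\mathbb{N}_0)$, $\mathbb{N}_0=\{0,1,2,\dots\}$. Let $(a_n)_{n\ge0}$ be positive numbers, $(b_n)_{n\ge0}$ real numbers, and $\mathcal{J}$ the infinite symmetric tridiagonal matrix with $\mathcal{J}_{n,n}=b_n$, $\mathcal{J}_{n,n+1}=\mathcal{J}_{n+1,n}=a_n$. The Jacobi operator $J$ is the closure in $\ell^2(\mathbb{N}_0)$ of the action of $\mathcal{J}$ on finitely supported sequences. It is assumed that $J$ is positive-definite and that $J^{-1}$ is a trace class operator on $\ell^2(\mathbb{N}_0)$; in particular $J$ is self-adjoint, $0$ is in its resolvent set, and its spectrum consists of simple eigenvalues $0<\zeta_1<\zeta_2<\cdots\to\infty$. The functions of the second kind are $w_n(z)=\langle\boldsymbol e_n,(J-zI)^{-1}\boldsymbol e_0\rangle$, $n\ge0$, and $w(z)=w_0(z)$. The characteristic function of $J$ is $\mathfrak{F}(z)=\prod_{n=1}^\infty(1-z/\zeta_n)$, and $\mathfrak{W}(z)=w(z)\mathfrak{F}(z)$, which is an entire function (all singularities are removable). The orthogonal polynomials of the second kind are defined by $Q_0(x)=0$, $Q_1(x)=1/a_0$, and $a_{n-1}Q_{n-1}(x)+b_nQ_n(x)+a_nQ_{n+1}(x)=xQ_n(x)$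 for $n\ge1$. *)

(* Defs.v *)
From HB Require Import structures.
From mathcomp Require Import all_boot all_order all_algebra.
From mathcomp Require Import all_classical all_reals all_analysis.
From mathcomp Require Import complex.

Set Implicit Arguments.
Unset Strict Implicit.
Unset Printing Implicit Defensive.

Import Order.TTheory GRing.Theory Num.Theory.
Import numFieldNormedType.Exports.

Local Open Scope classical_set_scope.
Local Open Scope ring_scope.
Local Open Scope complex_scope.

(* R[i] with the topology, and the normed module structure over itself, given
   by its modulus. *)
HB.instance Definition _ (R : realType) := NormedModule.copy R[i] R[i]^o.

Section SequenceHilbertSpace.
Context {R : realType}.
Implicit Types (u v x : nat -> R[i]) (T S P : (nat -> R[i]) -> nat -> R[i]).

Definition l2_sqnorm u : \bar R :=
  (\sum_(0 <= n <oo) ((complex.Re `|u n|) ^+ 2)%:E)%E.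

Definition l2 : set (nat -> R[i]) := [set u | (l2_sqnorm u < +oo)%E].

(* Antilinear in the first argument, linear in the second. *)
Definition l2_dot u v : R[i] := limn (series (fun n => (u n)^* * v n)).

Definition l2_basis (k : nat) : nat -> R[i] := fun n => (n == k)%:R.

(* An everywhere defined operator on l2 is a map on all sequences, of which
   only the restriction to l2 matters. *)
Definition l2_bounded T : Prop :=
  [/\ forall u, l2 u -> l2 (T u),
      forall (c : R[i]) u v, l2 u -> l2 v ->
        T (fun n => c * u n + v n) = (fun n => c * T u n + T v n)
    & exists M : R, forall u, l2 u ->
        (l2_sqnorm (T u) <= M%:E * l2_sqnorm u)%E].

Definition l2_adjoint T S : Prop :=
  forall u v, l2 u -> l2 v -> l2_dot (S u) v = l2_dot u (T v).

Definition l2_nonneg T : Prop := forall u, l2 u -> 0 <= l2_dot u (T u).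

(* P = |T|, the nonnegative square root of T* T. *)
Definition l2_absolute_value T P : Prop :=
  [/\ l2_bounded P, l2_nonneg P
    & exists S, [/\ l2_bounded S, l2_adjoint T S
        & forall u, l2 u -> P (P u) = S (T u)]].

(* T is bounded and tr |T| is finite. *)
Definition l2_trace_class T : Prop :=
  l2_bounded T /\
  exists2 P, l2_absolute_value T P &
    (\sum_(0 <= n <oo)
       (complex.Re (l2_dot (l2_basis n) (P (l2_basis n))))%:E < +oo)%E.

(* A possibly unbounded operator is represented by its graph: [A u v] means
   that u is in the domain of A and v = A u. *)
Implicit Types A : (nat -> R[i]) -> (nat -> R[i]) -> Prop.

(* A - z I. *)
Definition op_shift A (z : R[i]) : (nat -> R[i]) -> (nat -> R[i]) -> Prop :=
  fun u v => A u (fun n => v n + z * u n).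

Definition bounded_inverse A T : Prop :=
  l2_bounded T /\ forall u v, l2 v -> (A u v <-> u = T v).

Definition resolvent_set A : set R[i] :=
  [set z | exists T, bounded_inverse (op_shift A z) T].

Definition spectrum A : set R[i] := ~` resolvent_set A.

(* (A - z I)^-1; meaningful for z in the resolvent set of A and on l2 only,
   where it is uniquely determined. *)
Definition resolvent A (z : R[i]) : (nat -> R[i]) -> nat -> R[i] :=
  xget (T := (nat -> R[i]) -> nat -> R[i]) (fun u => u)
    [set T | bounded_inverse (op_shift A z) T].

Definition positive_definite A : Prop :=
  forall u v, A u v -> u <> (fun=> 0) -> 0 < l2_dot u v.

End SequenceHilbertSpace.

Section JacobiOperator.
Context {R : realType}.
Variables a b : nat -> R.

Definition jacobi_mx (m n : nat) : R :=
  if m == n then b n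
  else if m.+1 == n then a m
  else if n.+1 == m then a n
  else 0.

(* Row m of the matrix vanishes beyond column m + 1. *)
Definition jacobi_action (u : nat -> R[i]) : nat -> R[i] :=
  fun m => \sum_(n < m.+2) (jacobi_mx m n)%:C * u n.

Definition finitely_supported (u : nat -> R[i]) : Prop :=
  exists N, forall n, (N <= n)%N -> u n = 0.

(* The graph is the closure, in the product of l2 with itself, of the graph of
   the matrix action on finitely supported sequences. *)
Definition jacobi_op (u v : nat -> R[i]) : Prop :=
  [/\ l2 u, l2 v &
    forall e : R, 0 < e -> exists x, [/\ finitely_supported x,
      (l2_sqnorm (x \- u)%R < e%:E)%E
      & (l2_sqnorm (jacobi_action x \- v)%R < e%:E)%E]].

Definition second_kind_fun (n : nat) (z : R[i]) : R[i] :=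
  l2_dot (l2_basis n) (resolvent jacobi_op z (l2_basis 0)).

Fixpoint second_kind_poly (n : nat) : {poly R[i]} :=
  if n is m.+1 then
    if m is k.+1 then
      ((a m)^-1)%:C *: (('X - ((b m)%:C)%:P) * second_kind_poly m
                        - (a k)%:C *: second_kind_poly k)
    else (((a 0%N)^-1)%:C)%:P
  else 0.

Lemma second_kind_poly_rec (n : nat) (x : R[i]) : a n.+1 != 0 ->
  (a n)%:C * (second_kind_poly n).[x]
  + (b n.+1)%:C * (second_kind_poly n.+1).[x]
  + (a n.+1)%:C * (second_kind_poly n.+2).[x]
  = x * (second_kind_poly n.+1).[x].
Proof.
move=> an0.
have -> : second_kind_poly n.+2 =
  ((a n.+1)^-1)%:C *: (('X - ((b n.+1)%:C)%:P) * second_kind_poly n.+1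
                       - (a n)%:C *: second_kind_poly n) by [].
move: (second_kind_poly n.+1) => q; rewrite hornerZ mulrA -rmorphM /= divff // mul1r.
rewrite hornerD hornerN hornerM hornerZ hornerXsubC mulrBl.
by rewrite addrC addrA !subrK.
Qed.

(* zeta n is the (n+1)-st point of the spectrum, in increasing order. *)
Definition spectrum_enumeration (zeta : nat -> R) : Prop :=
  {homo zeta : m n / (m < n)%N >-> m < n} /\
  spectrum jacobi_op = [set (zeta n)%:C | n in [set: nat]].

Definition characteristic_fun (zeta : nat -> R) (z : R[i]) : R[i] :=
  limn (fun N => \prod_(0 <= n < N) (1 - z / (zeta n)%:C)).

(* w(z) F(z), extended to the spectrum by its limits: the singularities there
   are isolated and removable. *)
Definition regularized_weyl_fun (zeta : nat -> R) (z : R[i]) : R[i] :=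
  if `[< resolvent_set jacobi_op z >] then
    second_kind_fun 0 z * characteristic_fun zeta z
  else
    lim ((second_kind_fun 0 x * characteristic_fun zeta x) @[x --> z^']).

Definition second_kind_series (z : R[i]) : nat -> R[i] :=
  fun N => \sum_(1 <= n < N) second_kind_fun n 0 * (second_kind_poly n).[z].

End JacobiOperator.

Definition locally_uniform_cvg {U : topologicalType} {V : uniformType}
    (f : nat -> U -> V) (g : U -> V) : Prop :=
  forall x : U, exists2 B : set U, nbhs x B & {uniform B, f @ \oo --> g}.

(* Main.v *)
(* Let p_n and q_n be the orthogonal polynomials of the first and second kind,
   T = J^-1 and w_n = w_n(0).  The matrix of T is p_min(0) w_max, so it has
   trace sum p_k(0) w_k, which is finite because T <= |T|.  If f solves the
   recurrence with spectral parameter z and (J f)_0 = z f_0 + kap, then variation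
   of constants and Gronwall's inequality give |f_n| <= C exp(|z| tr T) |p_n(0)|,
   and f_n / p_n(0) tends to f_0 - kap w_0 - z sum w_k f_k; if this limit is 0,
   then f is recessive, that is f = O(w).
   For p(z) and q(z) the limits are D(z) and -E(z) with
   E(z) = w_0 + z sum w_k q_k(z), the right-hand side of the theorem.

   If D(z) = 0 then p(z) is an eigenvector; if not, D q + E p is recessive and
   the Green kernel built from it is the resolvent.  Hence the spectrum is the
   zero set of D, and on the resolvent set w(z) D(z) = E(z).

   It remains to see that D is the characteristic function.  By interlacing,
   p_n(z) / p_n(0) is the product over j < n of 1 - z y_(n,j), where y_(n,j) > 0
   increases with n and sum_j y_(n,j) is bounded; so D(z) is the product of the
   1 - z lam_j with lam_j = lim y_(n,j).  A double zero x of D would give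
   |D(x + i eps)| = O(eps^2), and then E(x) = 0 since |E(z)| |Im z| <= |D(z)|;
   but then p(x) and q(x) are both in l2, which contradicts the symmetry of J.
   So 1 / lam_j is the increasing enumeration of the spectrum. *)
Require Import Defs.
From mathcomp Require Import all_boot all_order all_algebra.
From mathcomp Require Import all_classical all_reals all_analysis.
From mathcomp Require Import complex polyrcf ring lra zify.

Set Implicit Arguments.
Unset Strict Implicit.
Unset Printing Implicit Defensive.

Import Order.TTheory GRing.Theory Num.Theory.
Import numFieldNormedType.Exports.

Local Open Scope classical_set_scope.
Local Open Scope ring_scope.
Local Open Scope complex_scope.

(** * Moduli, sums and limits *)

(** No complex function theory enters: the limit functions are known only as pointwise limits of
    polynomial quotients, and domination does the rest. Spectral parameter z is treated as a
    perturbation of parameter 0. There, the ratio g_n = w_n(0) / p_n(0) of the recessive to the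
    dominant solution is positive and decreases to 0: it decreases because positivity of J makes
    p_n(0) alternate in sign, and it tends to 0 because p(0) is not in l2. With g decreasing, every
    kernel that occurs is bounded by the weights p_k(0) w_k(0), so summability of these weights, the
    trace condition, is exactly what Gronwall's inequality asks for. The trace condition speaks of
    an operator P with P P = S T, where S is the adjoint of T; a comparison of the diagonals of T
    and P transfers it to T. The delicate point is multiplicity. The enumeration [zeta] lists the
    spectrum as a set, whereas distinct zeros of p_n could merge in the limit and repeat a factor of
    the product. The bound |E(z)| |Im z| <= |D(z)| that excludes this is the resolvent estimate
    |w(z)| <= 1 / |Im z|, obtained first for q_n and p_n. *)

Definition cmod {R : realType} (z : R[i]) : R := complex.Re `|z|.

Section Modulus.
Context {R : realType}.
Implicit Types (x y z : R[i]) (r : R).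

(** The norm of [R[i]] takes values in [R[i]], where the order is partial; [cmod] brings it back to
    [R], where suprema and [lra] are available. *)
Lemma normc_cmod z : `|z| = (cmod z)%:C.
Proof. by case: z => p q; rewrite /cmod normc_def. Qed.

Lemma cmodE z : cmod z = Num.sqrt (complex.Re z ^+ 2 + complex.Im z ^+ 2).
Proof. by rewrite /cmod normc_def. Qed.

Lemma cmod_ge0 z : 0 <= cmod z.
Proof. by rewrite cmodE sqrtr_ge0. Qed.

Lemma cmod0 : cmod (0 : R[i]) = 0.
Proof. by rewrite /cmod normr0. Qed.

Lemma cmod1 : cmod (1 : R[i]) = 1.
Proof. by rewrite /cmod normr1. Qed.

Lemma cmodM x y : cmod (x * y) = cmod x * cmod y.
Proof.
by apply: (@complexI R); rewrite -normc_cmod normrM !normc_cmod -rmorphM.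
Qed.

Lemma cmodN z : cmod (- z) = cmod z.
Proof. by rewrite /cmod normrN. Qed.

Lemma cmodC x y : cmod (x - y) = cmod (y - x).
Proof. by rewrite /cmod distrC. Qed.

Lemma cmodV z : cmod z^-1 = (cmod z)^-1.
Proof.
by apply: (@complexI R); rewrite -normc_cmod normfV normc_cmod fmorphV.
Qed.

Lemma cmod_real r : cmod r%:C = `|r|.
Proof. by rewrite cmodE /= expr0n addr0 sqrtr_sqr. Qed.

Lemma cmodJ z : cmod (conjc z) = cmod z.
Proof. by rewrite /cmod normcJ. Qed.

Lemma cmodD x y : cmod (x + y) <= cmod x + cmod y.
Proof.
by rewrite -(lecR _ (_ + _)) rmorphD /= -!normc_cmod ler_normD.
Qed.

Lemma cmodB x y : cmod (x - y) <= cmod x + cmod y.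
Proof. by rewrite -(cmodN y) cmodD. Qed.

Lemma cmod_dist z x y : cmod (x - y) <= cmod (x - z) + cmod (z - y).
Proof. by rewrite -[x - y](subrKA z) cmodD. Qed.

Lemma cmod_eq0 z : (cmod z == 0) = (z == 0).
Proof. by rewrite -(normr_eq0 z) normc_cmod -(inj_eq (@complexI R)). Qed.

Lemma cmod_gt0 z : (0 < cmod z) = (z != 0).
Proof. by rewrite lt_def cmod_ge0 andbT cmod_eq0. Qed.

Lemma cmod_le0 z : cmod z <= 0 -> z = 0.
Proof.
by move=> h; apply/eqP; rewrite -cmod_eq0 eq_le h cmod_ge0.
Qed.

Lemma cmod_ge_Re z : `|complex.Re z| <= cmod z.
Proof. by rewrite cmodE -sqrtr_sqr ler_wsqrtr // lerDl sqr_ge0. Qed.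

Lemma cmod_ge_Im z : `|complex.Im z| <= cmod z.
Proof. by rewrite cmodE -sqrtr_sqr ler_wsqrtr // lerDr sqr_ge0. Qed.

Lemma cmod_le_ReIm z : cmod z <= `|complex.Re z| + `|complex.Im z|.
Proof.
rewrite cmodE -[leRHS]ger0_norm ?addr_ge0 // -sqrtr_sqr ler_wsqrtr //.
rewrite sqrrD !real_normK ?num_real // addrAC lerDl.
by rewrite mulrn_wge0 // mulr_ge0.
Qed.

Lemma cmod_sqr z : (cmod z ^+ 2)%:C = conjc z * z.
Proof. by rewrite rmorphXn /= -normc_cmod sqr_normc mulrC. Qed.

Lemma cmod_sum m n (F : nat -> R[i]) :
  cmod (\sum_(m <= k < n) F k) <= \sum_(m <= k < n) cmod (F k).
Proof.
elim/big_ind2: _ => [|x p y q hx hy|//]; first by rewrite cmod0.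
exact: le_trans (cmodD _ _) (lerD hx hy).
Qed.

End Modulus.

Section RealSums.
Context {R : realType}.
Implicit Types (s t u v : nat -> R).

Lemma sumr_nat_ge0 t m n : (forall k, 0 <= t k) ->
  0 <= \sum_(m <= k < n) t k.
Proof. by move=> t0; apply: sumr_ge0. Qed.

Lemma ler_sum_widen t n m : (forall k, 0 <= t k) -> (n <= m)%N ->
  \sum_(0 <= k < n) t k <= \sum_(0 <= k < m) t k.
Proof.
by move=> t0 nm; rewrite (big_cat_nat (leq0n n) nm) //= lerDl sumr_nat_ge0.
Qed.

Lemma sum_nat_tail t n m : (n <= m)%N ->
  \sum_(n <= k < m) t k = \sum_(0 <= k < m) t k - \sum_(0 <= k < n) t k.
Proof. by move=> nm; rewrite (big_cat_nat (leq0n n) nm) //= addrAC subrr add0r. Qed.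

(** A partial sum within [e] of the supremum of all partial sums leaves less than [e] for the terms
    after it. *)
Lemma tail_small t M : (forall k, 0 <= t k) ->
  (forall n, \sum_(0 <= k < n) t k <= M) ->
  forall e, 0 < e -> exists m, forall n, \sum_(m <= k < n) t k < e.
Proof.
move=> t0 tM e e0.
pose A := [set \sum_(0 <= k < n) t k | n in [set: nat]].
have supA : has_sup A.
  split; first by exists (\sum_(0 <= k < 0) t k); exists 0%N.
  by exists M => _ [n _ <-].
have [_ [m _ <-] hm] := sup_adherent e0 supA.
exists m => n; have [mn|nm] := leqP m n; last by rewrite big_geq ?(ltnW nm).
rewrite sum_nat_tail // ltrBlDl.
have : \sum_(0 <= k < n) t k <= sup A by apply: ub_le_sup; [case: supA|exists n].
by move: hm; rewrite /A; lra.
Qed.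

Lemma sum_tail_le t M m n : (forall k, 0 <= t k) ->
  (forall n, \sum_(0 <= k < n) t k <= M) -> \sum_(m <= k < n) t k <= M.
Proof.
move=> t0 tM; apply: le_trans (tM n).
have [mn|nm] := leqP m n; last by rewrite big_geq ?(ltnW nm) // sumr_nat_ge0.
by rewrite sum_nat_tail // lerBlDr lerDl sumr_nat_ge0.
Qed.

Lemma cauchy_schwarz_nat m n u v :
  (\sum_(m <= k < n) u k * v k) ^+ 2 <=
  (\sum_(m <= k < n) u k ^+ 2) * (\sum_(m <= k < n) v k ^+ 2).
Proof.
have [nm|mn] := leqP n m; first by rewrite !big_geq // mulr0 expr0n.
elim: n mn => // n IH; rewrite ltnS leq_eqVlt => /predU1P[->|mn].
  by rewrite !big_nat1 exprMn.
rewrite !big_nat_recr ?(ltnW mn) //=.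
move: (IH mn); set s := \sum_(_ <= _ < _) _; set A := \sum_(_ <= _ < _) _.
set B := \sum_(_ <= _ < _) _ => sAB.
have A0 : 0 <= A by apply: sumr_ge0 => k _; exact: sqr_ge0.
have B0 : 0 <= B by apply: sumr_ge0 => k _; exact: sqr_ge0.
(* One more term adds a cross term to the left side; it is absorbed by [s ^+ 2 <= A * B] and the
   inequality of arithmetic and geometric means. *)
suff h : 2 * (s * (u n * v n)) <= A * v n ^+ 2 + B * u n ^+ 2.
  by rewrite sqrrD mulrDl !mulrDr exprMn; move: h sAB; lra.
have h0 : 0 <= A * v n ^+ 2 + B * u n ^+ 2.
  by rewrite addr_ge0 // mulr_ge0 // sqr_ge0.
apply: le_trans (ler_norm _) _; rewrite -(@ler_pXn2r _ 2%N) ?nnegrE //.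
rewrite real_normK ?num_real //.
have -> : (2 * (s * (u n * v n))) ^+ 2 = 4 * s ^+ 2 * (u n * v n) ^+ 2 by ring.
apply: (@le_trans _ _ (4 * (A * B) * (u n * v n) ^+ 2)).
  by rewrite ler_wpM2r ?sqr_ge0 // ler_wpM2l.
rewrite -subr_ge0.
have -> : (A * v n ^+ 2 + B * u n ^+ 2) ^+ 2 - 4 * (A * B) * (u n * v n) ^+ 2
   = (A * v n ^+ 2 - B * u n ^+ 2) ^+ 2 by ring.
exact: sqr_ge0.
Qed.

Lemma cauchy_schwarz_sqrt m n u v (U V : R) : 0 <= U -> 0 <= V ->
  (\sum_(m <= k < n) u k ^+ 2) <= U -> (\sum_(m <= k < n) v k ^+ 2) <= V ->
  \sum_(m <= k < n) u k * v k <= Num.sqrt U * Num.sqrt V.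
Proof.
move=> U0 V0 hU hV; apply: le_trans (ler_norm _) _.
rewrite -(@ler_pXn2r _ 2%N) ?nnegrE ?mulr_ge0 ?sqrtr_ge0 //.
rewrite real_normK ?num_real // exprMn !sqr_sqrtr //.
apply: le_trans (cauchy_schwarz_nat _ _ _ _) _.
by apply: ler_pM => //; apply: sumr_ge0 => k _; exact: sqr_ge0.
Qed.

End RealSums.

Section ComplexLimits.
Context {R : realType}.
Implicit Types (u v : nat -> R[i]) (l m c z : R[i]) (e M : R).

Definition ccvg u l := forall e, 0 < e ->
  exists N, forall n, (N <= n)%N -> cmod (u n - l) < e.

(** A positive element of [R[i]] has zero imaginary part, so tolerances in [R] are enough. *)
Lemma ccvgP u l : ccvg u l <-> u @ \oo --> l.
Proof.
split=> h.
  apply/cvgrPdist_lt => -[e e']; rewrite ltcE /= => /andP[/eqP -> e0'].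
  have [N hN] := h e e0'; exists N => // n /= Nn.
  by rewrite distrC normc_cmod ltcR hN.
move=> e e0; have /cvgrPdist_lt/(_ e%:C) := h.
rewrite ltcR => /(_ e0) [N _ hN]; exists N => n Nn.
by rewrite -ltcR -normc_cmod distrC; exact: hN.
Qed.

Lemma ccvg_lim u l : ccvg u l -> limn u = l.
Proof.
by move=> /ccvgP h; apply: cvg_lim; first exact: norm_hausdorff.
Qed.

Lemma ccvg_le u l c M : ccvg u l ->
  (exists N, forall n, (N <= n)%N -> cmod (u n - c) <= M) -> cmod (l - c) <= M.
Proof.
move=> ul [N hN]; apply/ler_addgt0Pr => e e0; have [N' hN'] := ul _ e0.
apply: le_trans (cmod_dist (u (maxn N N')) _ _) _.
rewrite addrC lerD ?hN ?leq_maxl // cmodC ltW // hN' // leq_maxr //.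
Qed.

Lemma ccvg_unique u l m : ccvg u l -> ccvg u m -> l = m.
Proof.
move=> ul um; apply/eqP; rewrite -subr_eq0; apply/eqP/cmod_le0.
apply/ler_addgt0Pr => e e0; rewrite add0r.
by apply: (ccvg_le ul); have [N hN] := um _ e0; exists N => n /hN /ltW.
Qed.

Lemma ccvg_lin u v l m c : ccvg u l -> ccvg v m ->
  ccvg (fun n => c * u n + v n) (c * l + m).
Proof.
move=> ul vm e e0; have c0 : 0 < cmod c + 1 by rewrite ltr_pwDr // cmod_ge0.
have [N hN] := ul (e / (2 * (cmod c + 1))) (divr_gt0 e0 (mulr_gt0 (ltr0Sn R 1) c0)).
have [N' hN'] := vm (e / 2) (divr_gt0 e0 (ltr0Sn R 1)).
exists (maxn N N') => n; rewrite geq_max => /andP[/hN h1 /hN' h2].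
have -> : c * u n + v n - (c * l + m) = c * (u n - l) + (v n - m) by ring.
apply: le_lt_trans (cmodD _ _) _; rewrite cmodM [e]splitr ler_ltD //.
apply: (@le_trans _ _ ((cmod c + 1) * (e / (2 * (cmod c + 1))))).
  by apply: ler_pM; rewrite ?cmod_ge0 ?ltW // ltrDl.
by rewrite le_eqVlt; apply/orP; left; apply/eqP; field; rewrite gt_eqF.
Qed.

Lemma ccvg_cst c : ccvg (fun=> c) c.
Proof. by move=> e e0; exists 0%N => n _; rewrite subrr cmod0. Qed.

Lemma ccvg_bounded u l : ccvg u l -> exists M, forall n, cmod (u n) <= M.
Proof.
move=> /(_ 1 ltr01)[N hN].
exists (\sum_(0 <= k < N) cmod (u k) + (cmod l + 1)) => n.
have [Nn|nN] := leqP N n.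
  rewrite -[u n](subrK l); apply: le_trans (cmodD _ _) _.
  have := hN _ Nn; have := sumr_nat_ge0 0 N (fun k => cmod_ge0 (u k)); lra.
rewrite (big_cat_nat (leq0n n) (ltnW nN)) /= (big_ltn nN).
have := sumr_nat_ge0 0 n (fun k => cmod_ge0 (u k)).
have := sumr_nat_ge0 n.+1 N (fun k => cmod_ge0 (u k)).
by have := cmod_ge0 l; lra.
Qed.

Lemma ccvgM u v l m : ccvg u l -> ccvg v m ->
  ccvg (fun n => u n * v n) (l * m).
Proof.
move=> ul vm; have [M hM] := ccvg_bounded ul.
have M0 : 0 <= M by apply: le_trans (hM 0%N); exact: cmod_ge0.
move=> e e0.
have M1 : 0 < M + 1 by lra.
have m1 : 0 < cmod m + 1 by have := cmod_ge0 m; lra.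
have [N1 h1] := vm (e / 2 / (M + 1)) (divr_gt0 (divr_gt0 e0 (ltr0Sn R 1)) M1).
have [N2 h2] := ul (e / 2 / (cmod m + 1)) (divr_gt0 (divr_gt0 e0 (ltr0Sn R 1)) m1).
exists (maxn N1 N2) => n; rewrite geq_max => /andP[/h1 a1 /h2 a2].
have -> : u n * v n - l * m = u n * (v n - m) + (u n - l) * m by ring.
apply: le_lt_trans (cmodD _ _) _; rewrite !cmodM [e]splitr.
apply: ltr_leD.
  apply: (@le_lt_trans _ _ ((M + 1) * cmod (v n - m))).
    by rewrite ler_wpM2r ?cmod_ge0 // (le_trans (hM n)) // lerDl.
  by rewrite mulrC -ltr_pdivlMr.
apply: (@le_trans _ _ (cmod (u n - l) * (cmod m + 1))).
  by rewrite ler_wpM2l ?cmod_ge0 // lerDl.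
by rewrite -ler_pdivlMr // ltW.
Qed.

End ComplexLimits.

(** * Absolutely convergent series and square summable sequences *)

Section ComplexSeries.
Context {R : realType}.
Implicit Types (u v : nat -> R[i]) (l m c z : R[i]) (e M : R).

Definition abssum u := exists M, forall n, \sum_(0 <= k < n) cmod (u k) <= M.

(** The same limit as in [l2_dot], so that the two agree by computation; it has a meaning only once
    convergence is known, usually through [abssum]. *)
Definition csum u : R[i] := limn (series u).

Lemma abssum_real_cvg (t : nat -> R) M :
  (forall n, \sum_(0 <= k < n) `|t k| <= M) -> cvgn (series t).
Proof.
move=> tM; apply: normed_cvg; apply: nondecreasing_is_cvgn.
  by apply: nondecreasing_series => *; exact: normr_ge0.
by exists M => _ [n _ <-]; exact: tM.
Qed.

Lemma Re_sum u (m n : nat) : complex.Re (\sum_(m <= k < n) u k) =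
  \sum_(m <= k < n) complex.Re (u k).
Proof. by apply: (big_morph (@complex.Re R)) => // -[? ?] [? ?]. Qed.

Lemma Im_sum u (m n : nat) : complex.Im (\sum_(m <= k < n) u k) =
  \sum_(m <= k < n) complex.Im (u k).
Proof. by apply: (big_morph (@complex.Im R)) => // -[? ?] [? ?]. Qed.

Lemma abssum_ccvg u : abssum u -> ccvg (series u) (csum u).
Proof.
move=> [M hM].
have reM n : \sum_(0 <= k < n) `|complex.Re (u k)| <= M.
  by apply: le_trans (hM n); apply: ler_sum => k _; exact: cmod_ge_Re.
have imM n : \sum_(0 <= k < n) `|complex.Im (u k)| <= M.
  by apply: le_trans (hM n); apply: ler_sum => k _; exact: cmod_ge_Im.
have /cvgrPdist_lt re := abssum_real_cvg reM.
have /cvgrPdist_lt im := abssum_real_cvg imM.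
set x := lim _ in re; set y := lim _ in im.
suff h : ccvg (series u) (x +i* y) by rewrite /csum (ccvg_lim h).
move=> e e0; have e2 : 0 < e / 2 by lra.
have [N _ hN] := re _ e2; have [N' _ hN'] := im _ e2.
exists (maxn N N') => n; rewrite geq_max => /andP[/hN h1 /hN' h2].
apply: le_lt_trans (cmod_le_ReIm _) _; rewrite /series /=.
have -> : complex.Re (\sum_(0 <= k < n) u k - x +i* y) =
    \sum_(0 <= k < n) complex.Re (u k) - x by rewrite -Re_sum; case: (\sum_(_ <= _ < _) _).
have -> : complex.Im (\sum_(0 <= k < n) u k - x +i* y) =
    \sum_(0 <= k < n) complex.Im (u k) - y by rewrite -Im_sum; case: (\sum_(_ <= _ < _) _).
rewrite [e]splitr ltrD // distrC; [exact: h1|exact: h2].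
Qed.

Lemma csum_eq u l : ccvg (series u) l -> csum u = l.
Proof. exact: ccvg_lim. Qed.

Lemma eq_csum u v : u =1 v -> csum u = csum v.
Proof. by move=> /funext->. Qed.

Lemma eq_abssum u v : u =1 v -> abssum u -> abssum v.
Proof. by move=> /funext->. Qed.

Lemma abssum_le u (t : nat -> R) : (forall k, cmod (u k) <= t k) ->
  (exists M, forall n, \sum_(0 <= k < n) t k <= M) -> abssum u.
Proof.
move=> ut [M tM]; exists M => n; apply: le_trans (tM n); exact: ler_sum.
Qed.

Lemma abssum_lin c u v : abssum u -> abssum v ->
  abssum (fun k => c * u k + v k).
Proof.
move=> [M hM] [M' hM'].
apply: (@abssum_le _ (fun k => cmod c * cmod (u k) + cmod (v k))).
  by move=> k; rewrite -cmodM cmodD.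
exists (cmod c * M + M') => n; rewrite big_split /= -mulr_sumr.
by rewrite lerD // ler_wpM2l ?cmod_ge0.
Qed.

Lemma abssum0 : abssum (fun=> 0).
Proof. by exists 0 => n; rewrite big1 // => i _; rewrite cmod0. Qed.

Lemma abssumZ c u : abssum u -> abssum (fun k => c * u k).
Proof.
by move=> /(abssum_lin c)/(_ abssum0); apply: eq_abssum => k; rewrite addr0.
Qed.

Lemma csum_lin c u v : abssum u -> abssum v ->
  csum (fun k => c * u k + v k) = c * csum u + csum v.
Proof.
move=> hu hv; apply: csum_eq.
have := ccvg_lin c (abssum_ccvg hu) (abssum_ccvg hv).
by congr ccvg; apply/funext => n; rewrite /series /= mulr_sumr big_split.
Qed.

Lemma csum0 : csum (fun=> 0) = 0.
Proof.
apply: csum_eq => e e0; exists 0%N => n _.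
by rewrite /series /= big1 // subr0 cmod0.
Qed.

Lemma csumZ c u : abssum u -> csum (fun k => c * u k) = c * csum u.
Proof.
move=> hu; have := csum_lin c hu abssum0; rewrite csum0 addr0 => <-.
by apply: eq_csum => k; rewrite addr0.
Qed.

Lemma csum_dist u (n : nat) M : abssum u ->
  (forall N, \sum_(n <= k < N) cmod (u k) <= M) ->
  cmod (csum u - \sum_(0 <= k < n) u k) <= M.
Proof.
move=> hu hM; apply: (ccvg_le (abssum_ccvg hu)); exists n => N nN.
rewrite /series /= (big_cat_nat (leq0n n) nN) /= addrAC subrr add0r.
exact: le_trans (cmod_sum _ _ _) (hM N).
Qed.

Lemma le_csum u M : (forall N, \sum_(0 <= k < N) cmod (u k) <= M) ->
  cmod (csum u) <= M.
Proof.
move=> hM; have hu : abssum u by exists M.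
by have := @csum_dist u 0 M hu hM; rewrite big_geq // subr0.
Qed.

Lemma csum_finite u N : (forall n, (N <= n)%N -> u n = 0) ->
  csum u = \sum_(0 <= k < N) u k.
Proof.
move=> u0; apply: csum_eq => e e0; exists N => n Nn.
rewrite /series /= (big_cat_nat (leq0n N) Nn) /= addrAC subrr add0r.
by rewrite big_nat_cond big1 ?cmod0 // => i /andP[/andP[/u0]].
Qed.

Lemma csum_conj u : abssum u -> csum (fun k => conjc (u k)) = conjc (csum u).
Proof.
move=> hu; apply: csum_eq => e e0; have [N hN] := abssum_ccvg hu e0.
exists N => n /hN; rewrite -cmodJ rmorphB /= /series /=.
by rewrite (big_morph _ (rmorphD (@conjc R)) (rmorph0 (@conjc R))).
Qed.

End ComplexSeries.

Section SquareSummable.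
Context {R : realType}.
Implicit Types (u v x : nat -> R[i]) (c z : R[i]) (e M : R).

Definition sq_le u M := forall n, \sum_(0 <= k < n) cmod (u k) ^+ 2 <= M.

Lemma sq_le_sqnorm u M : (l2_sqnorm u <= M%:E)%E <-> sq_le u M.
Proof.
split=> [h n|h]; last first.
  apply: lime_le.
    by apply: is_cvg_nneseries => k _ _; rewrite lee_fin sqr_ge0.
  by apply: nearW => n; rewrite sumEFin lee_fin; exact: h.
rewrite -lee_fin -sumEFin; apply: le_trans h.
apply: nneseries_lim_ge => k _; by rewrite lee_fin sqr_ge0.
Qed.

Lemma l2P u : l2 u <-> exists M, sq_le u M.
Proof.
split=> [h|[M /sq_le_sqnorm h]]; last first.
  by rewrite /l2 /=; apply: le_lt_trans h _; rewrite ltry.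
have h0 : (0 <= l2_sqnorm u)%E.
  by apply: nneseries_ge0 => k _ _; rewrite lee_fin sqr_ge0.
exists (fine (l2_sqnorm u)); apply/sq_le_sqnorm.
by rewrite fineK // ge0_fin_numE.
Qed.

Lemma sq_le_ge0 u M : sq_le u M -> 0 <= M.
Proof. by move=> /(_ 0%N); rewrite big_geq. Qed.

Lemma sq_le_scale c u M : sq_le u M ->
  sq_le (fun n => c * u n) (cmod c ^+ 2 * M).
Proof.
move=> h n; under eq_bigr do rewrite cmodM exprMn.
by rewrite -mulr_sumr ler_wpM2l // sqr_ge0.
Qed.

Lemma sq_le_add u v M M' : sq_le u M -> sq_le v M' ->
  sq_le (fun n => u n + v n) (2 * M + 2 * M').
Proof.
move=> h h' n; apply: (@le_trans _ _ (\sum_(0 <= k < n)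
   (2 * cmod (u k) ^+ 2 + 2 * cmod (v k) ^+ 2))).
  apply: ler_sum => k _; apply: (@le_trans _ _ ((cmod (u k) + cmod (v k)) ^+ 2)).
    by rewrite ler_sqr ?nnegrE ?addr_ge0 ?cmod_ge0 // cmodD.
  rewrite -subr_ge0; set p := cmod _; set q := cmod _.
  have -> : 2 * p ^+ 2 + 2 * q ^+ 2 - (p + q) ^+ 2 = (p - q) ^+ 2 by ring.
  exact: sqr_ge0.
by rewrite big_split /= -!mulr_sumr lerD // ler_wpM2l.
Qed.

Lemma l2Z c u : l2 u -> l2 (fun n => c * u n).
Proof. by move=> /l2P[M h]; apply/l2P; eexists; exact: sq_le_scale h. Qed.

Lemma l2D u v : l2 u -> l2 v -> l2 (fun n => u n + v n).
Proof.
by move=> /l2P[M h] /l2P[M' h']; apply/l2P; eexists; exact: sq_le_add h h'.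
Qed.

Lemma l2_lin c u v : l2 u -> l2 v -> l2 (fun n => c * u n + v n).
Proof. by move=> /(l2Z c); exact: l2D. Qed.

Lemma l2J u : l2 u -> l2 (fun n => conjc (u n)).
Proof.
move=> /l2P[M h]; apply/l2P; exists M => n.
by under eq_bigr do rewrite cmodJ.
Qed.

Lemma l2_le u v c : (forall n, cmod (u n) <= cmod (c * v n)) -> l2 v -> l2 u.
Proof.
move=> h /(l2Z c)/l2P[M hM]; apply/l2P; exists M => n.
apply: le_trans (hM n); apply: ler_sum => k _.
by rewrite ler_sqr ?nnegrE ?cmod_ge0.
Qed.

Lemma l2_fin u N : (forall n, (N <= n)%N -> u n = 0) -> l2 u.
Proof.
move=> u0; apply/l2P; exists (\sum_(0 <= k < N) cmod (u k) ^+ 2) => n.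
have [Nn|nN] := leqP N n; last first.
  by apply: ler_sum_widen (ltnW nN) => k; exact: sqr_ge0.
rewrite (big_cat_nat (leq0n N) Nn) /= gerDl big_nat_cond big1 //.
by move=> i /andP[/andP[/u0 ->]]; rewrite cmod0 expr0n.
Qed.

Lemma l2_basis_l2 k : l2 (@l2_basis R k).
Proof.
apply: (@l2_fin _ k.+1) => n kn; rewrite /l2_basis.
by case: eqP kn => // ->; rewrite ltnn.
Qed.

Lemma l2_0 : l2 (fun=> 0 : R[i]).
Proof. exact: (@l2_fin _ 0). Qed.

Lemma sq_le_pair u v M M' : sq_le u M -> sq_le v M' ->
  forall m n, \sum_(m <= k < n) cmod (u k * v k) <= Num.sqrt M * Num.sqrt M'.
Proof.
move=> h h' m n; under eq_bigr do rewrite cmodM.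
apply: cauchy_schwarz_sqrt; [exact: sq_le_ge0 h|exact: sq_le_ge0 h'| |].
  by apply: sum_tail_le => // k; exact: sqr_ge0.
by apply: sum_tail_le => // k; exact: sqr_ge0.
Qed.

Lemma l2_abssum u v : l2 u -> l2 v -> abssum (fun k => u k * v k).
Proof.
move=> /l2P[M h] /l2P[M' h']; exists (Num.sqrt M * Num.sqrt M') => n.
exact: sq_le_pair.
Qed.

Lemma l2_dotE u v : l2_dot u v = csum (fun k => conjc (u k) * v k).
Proof. by []. Qed.

Lemma l2_dot_basis k u : l2_dot (l2_basis k) u = u k.
Proof.
rewrite l2_dotE (@csum_finite _ _ k.+1); last first.
  move=> n kn; rewrite /l2_basis; case: eqP kn => [->|_ _]; first by rewrite ltnn.
  by rewrite conjc_nat mul0r.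
rewrite big_nat_recr //= /l2_basis eqxx conjc_nat mul1r big_nat_cond big1 ?add0r //.
by move=> i /andP[/andP[_ ik] _]; rewrite ltn_eqF // conjc_nat mul0r.
Qed.

End SquareSummable.

(** * The Jacobi matrix *)

Section JacobiAction.
Context {R : realType}.
Variables a b : nat -> R.
Local Notation jact := (jacobi_action a b).
Local Notation J := (jacobi_op a b).
Implicit Types (u v x y f : nat -> R[i]) (z c : R[i]).

Lemma jacobi_action0 u : jact u 0%N = (b 0%N)%:C * u 0%N + (a 0%N)%:C * u 1%N.
Proof. by rewrite /jacobi_action !big_ord_recr big_ord0 /= add0r. Qed.

Lemma jacobi_actionS u n : jact u n.+1 =
  (a n)%:C * u n + (b n.+1)%:C * u n.+1 + (a n.+1)%:C * u n.+2.
Proof.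
rewrite /jacobi_action 3!big_ord_recr /= big1 ?add0r => [|i _].
  rewrite /jacobi_mx !eqxx !eqSS.
  have -> : (n.+1 == n) = false by lia.
  have -> : (n.+2 == n) = false by lia.
  by have -> : (n == n.+1) = false by lia.
have := ltn_ord i; rewrite /jacobi_mx => ilt.
have -> : (n.+1 == i) = false by lia.
have -> : (n.+2 == i) = false by lia.
have -> : (i.+1 == n.+1 :> nat) = false by lia.
by rewrite mul0r.
Qed.

Lemma jacobi_action_lin c u v n :
  jact (fun k => c * u k + v k) n = c * jact u n + jact v n.
Proof. by case: n => [|n]; rewrite ?jacobi_action0 ?jacobi_actionS; ring. Qed.

Lemma jacobi_actionB u v n :
  jact (fun k => u k - v k) n = jact u n - jact v n.
Proof. by case: n => [|n]; rewrite ?jacobi_action0 ?jacobi_actionS; ring. Qed.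

Lemma jacobi_actionJ u n :
  jact (fun k => conjc (u k)) n = conjc (jact u n).
Proof.
by case: n => [|n]; rewrite ?jacobi_action0 ?jacobi_actionS;
  rewrite !rmorphD !rmorphM /= !oppr0.
Qed.

(** The matrix is symmetric, so interior terms cancel in pairs and only the Wronskian at the cut
    remains. *)
Lemma green_finite x y n :
  \sum_(0 <= k < n.+1) (jact x k * y k - x k * jact y k) =
  (a n)%:C * (x n.+1 * y n - x n * y n.+1).
Proof.
elim: n => [|n IH]; first by rewrite big_nat1 !jacobi_action0; ring.
by rewrite big_nat_recr //= IH !jacobi_actionS; ring.
Qed.

Lemma jacobi_action_supp x N : (forall n, (N <= n)%N -> x n = 0) ->
  forall n, (N.+1 <= n)%N -> jact x n = 0.
Proof.
move=> h [//|n]; rewrite ltnS => Nn; rewrite jacobi_actionS !h ?mulr0 ?addr0 //; lia.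
Qed.

Lemma green_supp x y N : (forall n, (N <= n)%N -> x n = 0) ->
  csum (fun k => jact x k * y k) = csum (fun k => x k * jact y k).
Proof.
move=> h; rewrite (@csum_finite _ _ N.+1); last first.
  by move=> n Nn; rewrite (jacobi_action_supp h) // mul0r.
rewrite (@csum_finite _ (fun k => x k * jact y k) N.+1); last first.
  by move=> n Nn; rewrite h ?mul0r // ltnW.
apply/eqP; rewrite -subr_eq0 -sumrB green_finite !h ?leqnSn //.
by rewrite !mul0r subrr mulr0.
Qed.

Lemma sq_le_sqnorm_lt u e : (l2_sqnorm u < e%:E)%E -> sq_le u e.
Proof. by move=> /ltW /sq_le_sqnorm. Qed.

Lemma csum_basis u n : csum (fun k => u k * l2_basis n k) = u n.
Proof.
rewrite -[RHS]l2_dot_basis l2_dotE; apply: eq_csum => k.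
by rewrite /l2_basis; case: eqP => _; rewrite ?conjc1 ?conjc0 mulrC.
Qed.

(** The identity for finitely supported sequences passes to the closure in the first argument. On
    the second argument only summability is imposed, so [y] need not be known to lie in the domain
    of [J]; this is how limit point arguments are run below. *)
Lemma green u v y : J u v -> l2 y -> l2 (jact y) ->
  csum (fun k => v k * y k) = csum (fun k => u k * jact y k).
Proof.
move=> [lu lv h] ly ly'; have /l2P[Y hY] := ly; have /l2P[Y' hY'] := ly'.
apply/eqP; rewrite -subr_eq0; apply/eqP/cmod_le0/ler_addgt0Pr => e e0; rewrite add0r.
(* Approximating [u] and [v] up to [e / s] in norm costs [e / s * (Num.sqrt Y + Num.sqrt Y')] by
   Cauchy-Schwarz; the summand 1 keeps [s] positive. *)
pose s := 1 + Num.sqrt Y + Num.sqrt Y'.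
have s0 : 0 < s by rewrite /s; have := sqrtr_ge0 Y; have := sqrtr_ge0 Y'; lra.
have d0 : 0 < (e / s) ^+ 2 by rewrite exprn_gt0 // divr_gt0.
have [x [[N xN] /sq_le_sqnorm_lt h1 /sq_le_sqnorm_lt h2]] := h _ d0.
have lx : l2 x by exact: l2_fin xN.
have ljx : l2 (jact x) by exact: l2_fin (jacobi_action_supp xN).
have -> : csum (fun k => v k * y k) - csum (fun k => u k * jact y k) =
    -1 * csum (fun k => (jact x \- v) k * y k) + csum (fun k => (x \- u) k * jact y k).
  have e1 : csum (fun k => (jact x \- v) k * y k) =
      csum (fun k => jact x k * y k) - csum (fun k => v k * y k).
    rewrite addrC -mulN1r -csum_lin; try exact: l2_abssum.
    by apply: eq_csum => k /=; ring.
  have e2 : csum (fun k => (x \- u) k * jact y k) =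
      csum (fun k => x k * jact y k) - csum (fun k => u k * jact y k).
    rewrite addrC -mulN1r -csum_lin; try exact: l2_abssum.
    by apply: eq_csum => k /=; ring.
  by rewrite e1 e2 (green_supp y xN); ring.
apply: le_trans (cmodD _ _) _; rewrite mulN1r cmodN.
have es0 : 0 <= e / s by rewrite divr_ge0 // ltW.
have -> : e = e / s * Num.sqrt Y + e / s * Num.sqrt Y' + e / s.
  by rewrite -mulrDr -[X in _ + X]mulr1 -mulrDr addrC addrA mulfVK // gt_eqF.
rewrite -[leLHS]addr0 lerD // -[X in X * Num.sqrt Y](ger0_norm es0) -[X in X * Num.sqrt Y'](ger0_norm es0).
by rewrite -!sqrtr_sqr lerD //; apply: le_csum => n; exact: sq_le_pair.
Qed.

(** Basis vectors are finitely supported, so pairing with them reads off each entry of [v]. *)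
Lemma jacobi_op_action u v : J u v -> jact u =1 v.
Proof.
move=> Juv n; have ln := @l2_basis_l2 R n.
have supp : forall k, (n.+1 <= k)%N -> @l2_basis R n k = 0.
  by move=> k nk; rewrite /l2_basis gtn_eqF.
have lj : l2 (jact (l2_basis n)) by exact: l2_fin (jacobi_action_supp supp).
have := green Juv ln lj; rewrite csum_basis => ->.
rewrite -(csum_basis (jact u) n).
rewrite -[RHS](eq_csum (u := fun k => jact (l2_basis n) k * u k)); last by move=> k; rewrite mulrC.
by rewrite (green_supp u supp); apply: eq_csum => k; rewrite mulrC.
Qed.

Lemma jacobi_op_supp x N : (forall n, (N <= n)%N -> x n = 0) -> J x (jact x).
Proof.
move=> xN; split; [exact: l2_fin xN|exact: l2_fin (jacobi_action_supp xN)|].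
have h0 (e : R) f : 0 < e -> (l2_sqnorm (f \- f)%R < e%:E)%E.
  move=> e0; apply: (@le_lt_trans _ _ 0%:E); last by rewrite lte_fin.
  apply/sq_le_sqnorm => n; rewrite big1 // => i _.
  by rewrite /= subrr cmod0 expr0n.
by move=> e e0; exists x; split; [exists N|exact: h0|exact: h0].
Qed.

End JacobiAction.

(** * The inverse of the Jacobi operator *)

Section FirstKind.
Context {R : realType}.
Variables a b : nat -> R.
Hypothesis a_gt0 : forall n, 0 < a n.
Local Notation jact := (jacobi_action a b).
Implicit Types (u v x y f g : nat -> R[i]) (z c : R[i]).

(** The coefficients are kept in [R], unlike those of [second_kind_poly], because the zeros are
    located by the intermediate value theorem. *)
Fixpoint first_kind_poly (n : nat) : {poly R} :=
  if n is m.+1 then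
    (a m)^-1 *: (('X - (b m)%:P) * first_kind_poly m
                 - (if m is k.+1 then a k *: first_kind_poly k else 0))
  else 1.

Definition first_kind z n : R[i] := (map_poly (real_complex R) (first_kind_poly n)).[z].

Lemma aC_neq0 n : (a n)%:C != 0.
Proof. by rewrite -[0]/(0%:C) (inj_eq (@complexI R)) gt_eqF. Qed.

Lemma first_kind0 z : first_kind z 0 = 1.
Proof. by rewrite /first_kind rmorph1 hornerE. Qed.

Lemma first_kind_poly1 :
  a 0%N *: first_kind_poly 1 = ('X - (b 0%N)%:P) * first_kind_poly 0.
Proof. by rewrite /= subr0 scalerA divff ?scale1r // gt_eqF. Qed.

Lemma first_kind_polyS n : a n.+1 *: first_kind_poly n.+2 =
  ('X - (b n.+1)%:P) * first_kind_poly n.+1 - a n *: first_kind_poly n.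
Proof.
rewrite [first_kind_poly n.+2]/(_ *: (_ * first_kind_poly n.+1 - _)).
by rewrite scalerA divff ?scale1r // gt_eqF.
Qed.

Lemma first_kind_action z n : jact (first_kind z) n = z * first_kind z n.
Proof.
case: n => [|n]; rewrite ?jacobi_action0 ?jacobi_actionS /first_kind.
  move: first_kind_poly1; move: (first_kind_poly 0) (first_kind_poly 1) => p q.
  move=> /(congr1 (fun p => (map_poly (real_complex R) p).[z])).
  by rewrite map_polyZ rmorphM rmorphB /= map_polyX map_polyC !hornerE => ->; ring.
move: (first_kind_polyS n).
move: (first_kind_poly n) (first_kind_poly n.+1) (first_kind_poly n.+2) => p q r.
move=> /(congr1 (fun p => (map_poly (real_complex R) p).[z])).
rewrite map_polyZ rmorphB rmorphM rmorphB /= map_polyX map_polyC map_polyZ !hornerE => ->.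
by ring.
Qed.

Lemma second_kind_action z n :
  jact (fun k => (second_kind_poly a b k).[z]) n =
  z * (second_kind_poly a b n).[z] + l2_basis 0 n.
Proof.
case: n => [|n]; rewrite ?jacobi_action0 ?jacobi_actionS.
  rewrite /= !hornerE /l2_basis eqxx -rmorphM /= divff ?gt_eqF //.
by rewrite second_kind_poly_rec ?gt_eqF // /l2_basis addr0.
Qed.

(** Row n determines entry n + 1 because [a n] is nonzero, so the first N rows fix the entries up to
    N inclusive. The cut at N matters for [T (l2_basis k)], which solves the homogeneous equation
    only in the rows before k. *)
Lemma jacobi_solution_unique f g z N : f 0%N = g 0%N ->
  (forall n, (n < N)%N -> jact f n - z * f n = jact g n - z * g n) ->
  forall n, (n <= N)%N -> f n = g n.
Proof.
move=> fg0 h n; have [m] := ubnP n; elim: m n => // m IH [|[|n]] // nm nN.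
  have := h 0%N nN; rewrite !jacobi_action0 fg0 => /addIr/addrI.
  exact: (mulfI (aC_neq0 _)).
have := h n.+1 nN; rewrite !jacobi_actionS.
rewrite (IH n) ?(IH n.+1); try lia.
move=> /addIr/addrI; exact: (mulfI (aC_neq0 _)).
Qed.

Lemma jacobi_eigen_unique f z N :
  (forall n, (n < N)%N -> jact f n = z * f n) ->
  forall n, (n <= N)%N -> f n = f 0%N * first_kind z n.
Proof.
move=> h; apply: (@jacobi_solution_unique _ _ z).
  by rewrite first_kind0 mulr1.
move=> n /h ->; have := jacobi_action_lin a b (f 0%N) (first_kind z) (fun=> 0) n.
rewrite first_kind_action; set f' := (fun k => _ + 0).
have -> : f' = (fun k => f 0%N * first_kind z k) by apply/funext => k; rewrite /f' addr0.
move=> ->; have -> : jact (fun=> 0) n = 0.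
  by case: n => [|n]; rewrite ?jacobi_action0 ?jacobi_actionS !mulr0 !addr0.
by ring.
Qed.

Lemma first_kind_real n (x : R) : first_kind x%:C n = ((first_kind_poly n).[x])%:C.
Proof. by rewrite /first_kind horner_map. Qed.

End FirstKind.

Section JacobiInverse.
Context {R : realType}.
Variables a b : nat -> R.
Hypothesis a_gt0 : forall n, 0 < a n.
Variable T : (nat -> R[i]) -> nat -> R[i].
Local Notation jact := (jacobi_action a b).
Local Notation J := (jacobi_op a b).
Hypothesis T_inv : bounded_inverse J T.
Implicit Types (u v x y f g : nat -> R[i]) (z c : R[i]).

(* P0 n and W0 n are p_n(0) and w_n(0). *)
Definition P0 n : R := (first_kind_poly a b n).[0].

Lemma P0C n : (P0 n)%:C = first_kind a b 0 n.
Proof. by rewrite -(rmorph0 (real_complex R)) first_kind_real. Qed.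

Lemma P0_0 : P0 0 = 1.
Proof. by rewrite /P0 /= hornerE. Qed.

Lemma T_l2 u : l2 u -> l2 (T u).
Proof. by case: T_inv => -[h _ _] _; exact: h. Qed.

Lemma T_jacobi v : l2 v -> J (T v) v.
Proof. by case: T_inv => _ h lv; apply/h. Qed.

Lemma T_action v n : l2 v -> jact (T v) n = v n.
Proof. by move=> /T_jacobi/jacobi_op_action. Qed.

Lemma T_green u v : l2 u -> l2 v ->
  csum (fun k => v k * T u k) = csum (fun k => T v k * u k).
Proof.
move=> lu lv; rewrite (@green _ a b (T v)) //; [|exact: T_jacobi|exact: T_l2|].
  by apply: eq_csum => k; rewrite T_action.
have -> : jact (T u) = u by apply/funext => k; rewrite T_action.
by [].
Qed.

Lemma T_entry v n : l2 v -> T v n = csum (fun k => v k * T (l2_basis n) k).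
Proof.
by move=> lv; rewrite T_green ?csum_basis //; exact: l2_basis_l2.
Qed.

Lemma T_sym k n : T (l2_basis k) n = T (l2_basis n) k.
Proof.
rewrite T_entry; last exact: l2_basis_l2.
under eq_csum do rewrite mulrC.
by rewrite csum_basis.
Qed.

Lemma T_self_adjoint u v : l2 u -> l2 v -> l2_dot u (T v) = l2_dot (T u) v.
Proof.
move=> lu lv; rewrite !l2_dotE.
have lTu : l2 (fun k => conjc (T u k)) by apply/l2J/T_l2.
have h : (fun n => conjc (u n)) = jact (fun k => conjc (T u k)).
  by apply/funext => n; rewrite jacobi_actionJ T_action.
transitivity (csum (fun k => T v k * conjc (u k))).
  by apply: eq_csum => k; rewrite mulrC.
have e : (fun k => T v k * conjc (u k)) = (fun k => T v k * jact (fun k => conjc (T u k)) k).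
  by apply/funext => k; rewrite -h.
rewrite e -(@green _ a b (T v) v) //; [|exact: T_jacobi|].
  by apply: eq_csum => k; rewrite mulrC.
by rewrite -h; exact: l2J.
Qed.

(** Otherwise Green's formula for [T (l2_basis 0)] and [P0] would read 1 = 0, since [P0] starts with
    1 and is annihilated by the matrix. *)
Lemma P0_not_l2 : ~ l2 (fun n => (P0 n)%:C : R[i]).
Proof.
move=> lP.
have jP : jact (fun n => (P0 n)%:C) = (fun=> 0).
  apply/funext => n; have -> : (fun n => (P0 n)%:C : R[i]) = first_kind a b 0.
    by apply/funext => k; rewrite P0C.
  by rewrite first_kind_action // mul0r.
have := @green _ a b _ _ (fun n => (P0 n)%:C) (T_jacobi (@l2_basis_l2 R 0)) lP.
rewrite jP => /(_ (@l2_0 R)).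
under [in LHS]eq_csum do rewrite mulrC.
rewrite csum_basis P0_0; under eq_csum do rewrite mulr0.
by rewrite csum0 => /eqP; rewrite oner_eq0.
Qed.

Lemma jacobi_action_injective u : l2 u -> (forall n, jact u n = 0) -> forall n, u n = 0.
Proof.
move=> lu ju n.
have h k : u k = u 0%N * (P0 k)%:C.
  rewrite P0C; apply: (@jacobi_eigen_unique _ a b a_gt0 u 0 k) => // m _.
  by rewrite ju mul0r.
have [u0|u0] := eqVneq (u 0%N) 0; first by rewrite h u0 mul0r.
case: P0_not_l2; have := l2Z (u 0%N)^-1 lu.
by congr l2; apply/funext => k; rewrite (h k) mulKf.
Qed.

(** The closure is already the maximal operator: [T v] solves the same equation, and the matrix is
    injective on l2. From here on, membership in the domain of [J] is checked by square summability
    alone. *)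
Lemma jacobi_op_max u v : l2 u -> l2 v -> (forall n, jact u n = v n) -> J u v /\ u = T v.
Proof.
move=> lu lv juv.
have e : u = T v.
  apply/funext => n; apply/eqP; rewrite -subr_eq0; apply/eqP.
  apply: (@jacobi_action_injective (fun n => u n - T v n)).
    have := l2_lin (-1) (T_l2 lv) lu.
    by congr l2; apply/funext => k; ring.
  by move=> m; rewrite jacobi_actionB juv T_action // subrr.
by split=> //; rewrite e; exact: T_jacobi.
Qed.

Hypothesis J_pos : positive_definite J.

Definition W0 n : R := complex.Re (T (l2_basis 0) n).

Lemma T_basis_diag_gt0 k : 0 < T (l2_basis k) k.
Proof.
have lk := @l2_basis_l2 R k.
have /J_pos : J (T (l2_basis k)) (l2_basis k) by exact: T_jacobi.
rewrite l2_dotE csum_basis => h.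
have {h}: 0 < conjc (T (l2_basis k) k).
  apply: h => h; have := T_action k lk.
  rewrite h /l2_basis eqxx; have -> : jact (fun=> 0) k = 0.
    by case: (k) => [|n]; rewrite ?jacobi_action0 ?jacobi_actionS !mulr0 !addr0.
  by move=> /esym/eqP; rewrite oner_eq0.
by rewrite !lt_def !conjc_eq0 !conj_ge0.
Qed.

(** In the rows before k the vector [T (l2_basis k)] solves the homogeneous equation, hence is a
    multiple of [P0] up to index k; symmetry identifies the factor. *)
Lemma T_basis_le n k : (n <= k)%N ->
  T (l2_basis k) n = (P0 n)%:C * T (l2_basis 0) k.
Proof.
move=> nk; rewrite T_sym [T (l2_basis 0) k]T_sym -T_sym mulrC P0C.
apply: (@jacobi_eigen_unique _ a b a_gt0 (T (l2_basis k)) 0 k) => // m mk.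
rewrite T_action; last exact: l2_basis_l2.
by rewrite mul0r /l2_basis ltn_eqF.
Qed.

(** The diagonal entry [T (l2_basis n) n] is a positive real number and equals the real number
    [P0 n] times this entry. *)
Lemma W0C n : T (l2_basis 0) n = (W0 n)%:C.
Proof.
have := T_basis_diag_gt0 n; rewrite T_basis_le // ltcE /= => /andP[/eqP h h'].
have : complex.Im (T (l2_basis 0) n) = 0.
  move: h h'; case: (T _ n) => p q /=; rewrite !mul0r subr0 addr0 => /eqP.
  by rewrite mulf_eq0 => /orP[/eqP->|/eqP //]; rewrite mul0r ltxx.
by rewrite /W0; case: (T _ n) => p q /= ->.
Qed.

Lemma T_basisE k n : T (l2_basis k) n =
  (if (n <= k)%N then P0 n * W0 k else P0 k * W0 n)%:C.
Proof.
case: leqP => h; first by rewrite T_basis_le // W0C rmorphM.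
by rewrite T_sym T_basis_le ?W0C ?rmorphM // ltnW.
Qed.

Lemma P0W0_gt0 n : 0 < P0 n * W0 n.
Proof. by have := T_basis_diag_gt0 n; rewrite T_basisE leqnn ltcR. Qed.

Lemma P0_action n : jact (fun k => (P0 k)%:C) n = 0.
Proof.
have -> : (fun n => (P0 n)%:C : R[i]) = first_kind a b 0.
  by apply/funext => k; rewrite P0C.
by rewrite first_kind_action // mul0r.
Qed.

Lemma W0_action n : jact (fun k => (W0 k)%:C) n = l2_basis 0 n.
Proof.
have -> : (fun k => (W0 k)%:C : R[i]) = T (l2_basis 0).
  by apply/funext => k; rewrite W0C.
by rewrite T_action //; exact: l2_basis_l2.
Qed.

(* Positivity tested on the truncation of P0 to [0, n]. *)
Lemma P0_alternate n : P0 n * P0 n.+1 < 0.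
Proof.
pose x k : R[i] := if (k <= n)%N then (P0 k)%:C else 0.
have xN m : (n.+1 <= m)%N -> x m = 0 by move=> h; rewrite /x leqNgt h.
have : 0 < l2_dot x (jact x).
  apply: J_pos (jacobi_op_supp a b xN) _ => /(congr1 (fun f => f 0%N)).
  by rewrite /x leq0n P0_0 => /eqP; rewrite oner_eq0.
rewrite l2_dotE (@csum_finite _ _ n.+1); last first.
  by move=> m /xN ->; rewrite conjc0 mul0r.
have -> : \sum_(0 <= k < n.+1) conjc (x k) * jact x k =
   \sum_(0 <= k < n.+1) (jact x k * (P0 k)%:C - x k * jact (fun k => (P0 k)%:C) k).
  apply: eq_big_nat => k /andP[_ kn]; rewrite P0_action mulr0 subr0 mulrC.
  by rewrite /x -ltnS kn conjc_real.
rewrite green_finite xN // mul0r sub0r /x leqnn -rmorphM -rmorphN -rmorphM /= ltcR.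
by rewrite mulrN oppr_gt0 pmulr_rlt0.
Qed.

Lemma W0P0_wronskian n : a n * (W0 n.+1 * P0 n - W0 n * P0 n.+1) = 1.
Proof.
apply: (@complexI R); rewrite rmorphM rmorphB !rmorphM /=.
have := green_finite a b (fun k => (W0 k)%:C) (fun k => (P0 k)%:C) n.
move=> <-.
under eq_bigr do rewrite W0_action P0_action mulr0 subr0.
rewrite big_nat_recl //= /l2_basis eqxx mul1r P0_0 big1 ?addr0 // => i _.
by rewrite mul0r.
Qed.

End JacobiInverse.

(** * The trace *)

(* If T - A took a positive value, take u almost maximizing the quotient
   <u, (T - A) u> / <u, u>, with supremum lam > 0: then (T - A) u is close to
   lam u, so 0 = |T u|^2 - |A u|^2 = <(T - A) u, (T + A) u> is close to
   lam <u, (T + A) u>, which is at least lam <u, (T - A) u>, hence positive. *)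
Lemma le_of_eq_norm (R : realType) (V : Type) (comb : R -> V -> V -> V)
    (ip : V -> V -> R) (T A : V -> V) (K : R) :
  (forall u v, ip u v = ip v u) ->
  (forall c u v w, ip w (comb c u v) = c * ip w u + ip w v) ->
  (forall u, 0 <= ip u u) ->
  (forall c u v w, ip w (T (comb c u v)) = c * ip w (T u) + ip w (T v)) ->
  (forall c u v w, ip w (A (comb c u v)) = c * ip w (A u) + ip w (A v)) ->
  (forall u v, ip u (T v) = ip (T u) v) ->
  (forall u v, ip u (A v) = ip (A u) v) ->
  (forall u, ip (T u) (T u) <= K * ip u u) ->
  (forall u, ip (A u) (A u) <= K * ip u u) ->
  (forall u, 0 <= ip u (A u)) ->
  (forall u, ip (T u) (T u) = ip (A u) (A u)) ->
  forall u, ip u (T u) <= ip u (A u).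
Proof.
move=> ipC ip_lin ip_ge0 T_lin A_lin T_sym A_sym T_bd A_bd A_ge0 TA u0.
rewrite leNgt; apply/negP => u0_gt.
have ip_linl c u v w : ip (comb c u v) w = c * ip u w + ip v w.
  by rewrite ipC ip_lin !(ipC w).
have amgm s u v : 0 <= s ^+ 2 * ip u u + 2 * s * ip u v + ip v v.
  have := ip_ge0 (comb s u v); rewrite !ip_lin !ip_linl (ipC v u).
  by move=> h; apply: le_trans h _; rewrite le_eqVlt; apply/orP; left; apply/eqP; ring.
pose q u := ip u (T u) - ip u (A u).
have q_le u : q u <= (1 + K) * ip u u.
  have := amgm (-1) u (T u); have := amgm 1 u (A u).
  by have := T_bd u; have := A_bd u; have := ip_ge0 u; rewrite /q; lra.
have u0_pos : 0 < ip u0 u0.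
  rewrite lt_def ip_ge0 andbT; apply/eqP => h.
  by move: (q_le u0) u0_gt; rewrite h mulr0 /q; lra.
have K0 : 0 <= K.
  by rewrite -(pmulr_lge0 _ u0_pos); apply: le_trans (T_bd u0); exact: ip_ge0.
pose S := [set q u / ip u u | u in [set u | 0 < ip u u]].
have supS : has_sup S.
  split; first by exists (q u0 / ip u0 u0), u0.
  by exists (1 + K) => _ [u /= hu <-]; rewrite ler_pdivrMr.
pose lam := sup S.
have lam_ge u : q u <= lam * ip u u.
  have := ip_ge0 u; rewrite le_eqVlt => /predU1P[e|hu].
    by have := q_le u; rewrite -e !mulr0.
  rewrite -ler_pdivrMr //; apply: ub_le_sup; first by case: supS.
  by exists u.
have lam_gt0 : 0 < lam.
  have := lam_ge u0; rewrite -(pmulr_lgt0 _ u0_pos); apply: lt_le_trans.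
  by rewrite subr_gt0.
pose C := lam + (1 + K).
have C_gt0 : 0 < C by rewrite /C; lra.
(* The weight [s] makes [s * lam ^+ 2] larger than the bound [4 * K] for the quotient of |(T + A)
   u|^2 by |u|^2. Then [d] is so small that the errors [2 * s * lam * d] and [s ^+ 2 * C * d]
   together take at most half of [s * lam ^+ 2]. *)
pose s := 2 * (4 * K + 1) / lam ^+ 2.
have lam2 : 0 < lam ^+ 2 by rewrite exprn_gt0.
have s_gt0 : 0 < s by rewrite divr_gt0 //; lra.
pose d := lam ^+ 2 / (4 * (lam + s * C)).
have sC : 0 < s * C by rewrite mulr_gt0.
have d_gt0 : 0 < d by rewrite divr_gt0 //; lra.
have [_ [u /= u_pos <-] hu] := sup_adherent d_gt0 supS.
have {hu} hu : (lam - d) * ip u u < q u by rewrite -ltr_pdivlMr.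
pose X v := comb (-1) (A v) (T v).
have [r rE] : exists r, r = comb (- lam) u (X u) by eexists.
have Xr v w : ip v (X w) = ip v (T w) - ip v (A w) by rewrite /X ip_lin; ring.
have X_sym v w : ip v (X w) = ip (X v) w.
  by rewrite Xr ip_linl T_sym A_sym; ring.
(* The definition of [lam] is tested on u + r / C. The form of lam - (T - A) is bounded by [C], so
   the first order gain 2 |r|^2 / C exceeds the second order loss |r|^2 / C, and the difference is
   at most d |u|^2. *)
have r_le : ip r r <= C * (d * ip u u).
  have := lam_ge (comb C^-1 r u).
  have -> : q (comb C^-1 r u) = q u + 2 * C^-1 * ip r (X u) + C^-1 ^+ 2 * q r.
    rewrite /q !T_lin !A_lin !ip_linl Xr.
    rewrite [ip u (T r)]T_sym [ip u (A r)]A_sym [ip (T u) r]ipC [ip (A u) r]ipC.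
    by ring.
  have -> : ip r (X u) = ip r r + lam * ip r u by have := ip_lin (- lam) u (X u) r; rewrite -rE; lra.
  rewrite !ip_lin !ip_linl (ipC u r).
  have qr : - q r <= (1 + K) * ip r r.
    have := amgm 1 r (T r); have := amgm (-1) r (A r).
    by have := T_bd r; have := A_bd r; have := ip_ge0 r; rewrite /q; lra.
  move=> h.
  have h1 : 2 * C^-1 * ip r r <= d * ip u u + C^-1 ^+ 2 * (lam * ip r r - q r).
    by move: hu h; lra.
  have h2 : C^-1 ^+ 2 * (lam * ip r r - q r) <= C^-1 ^+ 2 * (C * ip r r).
    by rewrite ler_wpM2l ?sqr_ge0 // /C; lra.
  have e2 : C^-1 ^+ 2 * (C * ip r r) = C^-1 * ip r r by field; rewrite gt_eqF.
  have h3 : C^-1 * ip r r <= d * ip u u by lra.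
  by rewrite mulrC -ler_pdivrMr // mulrC.
have Y_le : ip (comb 1 (A u) (T u)) (comb 1 (A u) (T u)) <= 4 * K * ip u u.
  rewrite !ip_lin !ip_linl [ip (T u) (A u)]ipC.
  have := amgm (-1) (A u) (T u); have := T_bd u; have := A_bd u; lra.
have key : 0 = lam * (ip u (T u) + ip u (A u)) + ip r (comb 1 (A u) (T u)).
  rewrite rE ip_linl /X ip_linl !ip_lin TA [ip (T u) (A u)]ipC; ring.
have := amgm s r (comb 1 (A u) (T u)).
have lq : lam * ((lam - d) * ip u u) <= lam * (ip u (T u) + ip u (A u)).
  rewrite ler_wpM2l ?(ltW lam_gt0) //; apply: le_trans (ltW hu) _.
  by have := A_ge0 u; rewrite /q; lra.
set y := ip r _ in key *; move=> h.
have y_le : lam * ((lam - d) * ip u u) <= - y by lra.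
have s2r : s ^+ 2 * ip r r <= s ^+ 2 * (C * (d * ip u u)).
  by rewrite ler_wpM2l // sqr_ge0.
have h2 : 2 * s * (lam * ((lam - d) * ip u u)) <=
    s ^+ 2 * (C * (d * ip u u)) + 4 * K * ip u u.
  have : 2 * s * (lam * ((lam - d) * ip u u)) <= 2 * s * - y.
    by rewrite ler_wpM2l // mulr_ge0 // ltW.
  by move: Y_le s2r h; lra.
have h3 : 2 * s * (lam * (lam - d)) <= s ^+ 2 * (C * d) + 4 * K.
  by rewrite -(ler_pM2r u_pos); move: h2; lra.
have ed : d * (lam + s * C) = lam ^+ 2 / 4.
  by rewrite /d; field; rewrite gt_eqF //; lra.
have es : s * lam ^+ 2 = 2 * (4 * K + 1) by rewrite /s divfK ?gt_eqF.
have : s * (d * (lam + s * C)) = s * lam ^+ 2 / 4 by rewrite ed; ring.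
have := mulr_ge0 (sqr_ge0 s) (ltW (mulr_gt0 C_gt0 d_gt0)).
by move: h3 es K0; lra.
Qed.

Section InnerProduct.
Context {R : realType}.
Implicit Types (u v w : nat -> R[i]) (c : R[i]).

Lemma l2_dot_lin c u v w : l2 u -> l2 v -> l2 w ->
  l2_dot w (fun n => c * u n + v n) = c * l2_dot w u + l2_dot w v.
Proof.
move=> lu lv lw; rewrite !l2_dotE -csum_lin; try exact: l2_abssum (l2J lw) _.
by apply: eq_csum => k; ring.
Qed.

Lemma l2_dotC u v : l2 u -> l2 v -> l2_dot v u = conjc (l2_dot u v).
Proof.
move=> lu lv; rewrite !l2_dotE -csum_conj; last exact: l2_abssum (l2J lu) lv.
by apply: eq_csum => k; rewrite rmorphM /= conjcK mulrC.
Qed.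

Lemma l2_dot_linl c u v w : l2 u -> l2 v -> l2 w ->
  l2_dot (fun n => c * u n + v n) w = conjc c * l2_dot u w + l2_dot v w.
Proof.
move=> lu lv lw; rewrite l2_dotC //; last exact: l2_lin.
by rewrite l2_dot_lin // rmorphD rmorphM /= -!l2_dotC.
Qed.

Definition ip u v : R := complex.Re (l2_dot u v).

Lemma ReD (x y : R[i]) : complex.Re (x + y) = complex.Re x + complex.Re y.
Proof. by case: x; case: y. Qed.

Lemma ReZ (r : R) (x : R[i]) : complex.Re (r%:C * x) = r * complex.Re x.
Proof. by case: x => p q /=; rewrite mul0r subr0. Qed.

Lemma ipC u v : l2 u -> l2 v -> ip u v = ip v u.
Proof. by move=> lu lv; rewrite /ip l2_dotC //; case: l2_dot. Qed.

Lemma ip_lin (r : R) u v w : l2 u -> l2 v -> l2 w ->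
  ip w (fun n => r%:C * u n + v n) = r * ip w u + ip w v.
Proof. by move=> lu lv lw; rewrite /ip l2_dot_lin // ReD ReZ. Qed.

Lemma series_norm u n :
  series (fun k => conjc (u k) * u k) n = (\sum_(0 <= k < n) cmod (u k) ^+ 2)%:C.
Proof.
rewrite /series /= rmorph_sum /=; apply: eq_bigr => k _.
by rewrite cmod_sqr.
Qed.

Lemma l2_dot_norm u : l2 u -> l2_dot u u = (ip u u)%:C.
Proof.
move=> lu; have := abssum_ccvg (l2_abssum (l2J lu) lu); rewrite /ip l2_dotE.
set x := csum _ => h; suff : complex.Im x = 0 by case: x {h} => p q /= ->.
apply/eqP; rewrite -normr_le0; apply/ler_addgt0Pr => e /h[N hN].
rewrite add0r; apply: le_trans (ltW (hN _ (leqnn _))).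
rewrite series_norm; apply: le_trans (cmod_ge_Im _).
by case: (x) => p q /=; rewrite sub0r normrN.
Qed.

Lemma sq_le_ip u : l2 u -> sq_le u (ip u u).
Proof.
move=> lu n; apply/ler_addgt0Pr => e e0.
have := abssum_ccvg (l2_abssum (l2J lu) lu).
rewrite -l2_dotE l2_dot_norm // => /(_ e e0)[N hN].
have := hN (maxn N n) (leq_maxl _ _).
rewrite series_norm -rmorphB cmod_real ltr_norml => /andP[_].
have := @ler_sum_widen R (fun k => cmod (u k) ^+ 2) n (maxn N n) (fun k => sqr_ge0 _) (leq_maxr _ _).
lra.
Qed.

Lemma ip_ge0 u : l2 u -> 0 <= ip u u.
Proof. by move=> /sq_le_ip/sq_le_ge0. Qed.

Lemma ip_le u M : l2 u -> sq_le u M -> ip u u <= M.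
Proof.
move=> lu hM; apply/ler_addgt0Pr => e e0.
have := abssum_ccvg (l2_abssum (l2J lu) lu).
rewrite -l2_dotE l2_dot_norm // => /(_ e e0)[N hN].
have := hN N (leqnn _); rewrite series_norm -rmorphB cmod_real ltr_norml => /andP[].
have := hM N; lra.
Qed.

Lemma l2_bounded_ip (T : (nat -> R[i]) -> nat -> R[i]) : l2_bounded T ->
  exists2 K, 0 <= K & forall u, l2 u -> ip (T u) (T u) <= K * ip u u.
Proof.
move=> [Tl2 _ [M hM]]; exists `|M| => // u lu.
apply: ip_le; first exact: Tl2.
apply/sq_le_sqnorm; apply: le_trans (hM u lu) _.
have h0 : (0 <= l2_sqnorm u)%E.
  by apply: nneseries_ge0 => k _ _; rewrite lee_fin sqr_ge0.
apply: (@le_trans _ _ (`|M|%:E * l2_sqnorm u)%E).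
  by rewrite lee_wpmul2r // lee_fin ler_norm.
rewrite EFinM lee_wpmul2l ?lee_fin //.
by apply/sq_le_sqnorm; exact: sq_le_ip.
Qed.

(* Polarization: the quadratic form of A is real. *)
Lemma l2_nonneg_self_adjoint (A : (nat -> R[i]) -> nat -> R[i]) u v :
  l2_bounded A -> l2_nonneg A -> l2 u -> l2 v ->
  l2_dot u (A v) = l2_dot (A u) v.
Proof.
move=> [Al2 Alin _] A0 lu lv.
have im0 w : l2 w -> complex.Im (l2_dot w (A w)) = 0.
  by move=> /A0; exact: ger0_Im.
rewrite [RHS](l2_dotC lv (Al2 _ lu)).
have h c : complex.Im (c * l2_dot v (A u) + conjc c * l2_dot u (A v)) = 0.
  have := im0 _ (l2_lin c lu lv).
  rewrite (Alin c u v lu lv) (l2_dot_lin c (Al2 _ lu) (Al2 _ lv) (l2_lin c lu lv)).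
  rewrite (l2_dot_linl c lu lv (Al2 _ lu)) (l2_dot_linl c lu lv (Al2 _ lv)).
  rewrite mulrDr mulrA.
  have := im0 _ lu; have := im0 _ lv.
  have -> : c * conjc c = (cmod c ^+ 2)%:C by rewrite cmod_sqr mulrC.
  case: (l2_dot u (A u)) => p q; case: (l2_dot v (A v)) => p' q' /= -> ->.
  case: (c * _) => ? ?; case: (conjc c * _) => ? ? /=.
  by rewrite mulr0 mul0r !addr0 add0r.
(* The choice c = 1 relates the imaginary parts of the two products, and c = i the real parts. *)
have := h 1; have := h 'i%C; move: (l2_dot v (A u)) (l2_dot u (A v)) => [p q] [p' q'] /=.
rewrite !mul0r !mul1r !mulN1r !oppr0 !mul0r !addr0 !add0r => h1 h2.
by apply/eqP; rewrite eq_complex /=; apply/andP; split; apply/eqP; move: h1 h2; lra.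
Qed.

End InnerProduct.

Section TraceBound.
Context {R : realType}.
Variables a b : nat -> R.
Hypothesis a_gt0 : forall n, 0 < a n.
Variable T : (nat -> R[i]) -> nat -> R[i].
Local Notation J := (jacobi_op a b).
Hypothesis T_inv : bounded_inverse J T.
Hypothesis J_pos : positive_definite J.

Lemma le_absolute_value A u : l2_absolute_value T A -> l2 u ->
  ip u (T u) <= ip u (A u).
Proof.
move=> [bA A0 [S [bS TS AA]]] lu; have bT : l2_bounded T by case: T_inv.
have [Tl2 Tlin _] := bT; have [Al2 Alin _] := bA; have [Sl2 _ _] := bS.
have [K K0 TK] := l2_bounded_ip bT; have [K' K'0 AK] := l2_bounded_ip bA.
(* The laws of the inner product hold on l2 only, whereas [le_of_eq_norm] demands them on a whole
   type; hence the subtype, regarded as a real inner product space. *)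
pose V := {w : nat -> R[i] | l2 w}.
pose comb (c : R) (v w : V) : V := exist _ _ (l2_lin c%:C (svalP v) (svalP w)).
pose T' (v : V) : V := exist _ _ (Tl2 _ (svalP v)).
pose A' (v : V) : V := exist _ _ (Al2 _ (svalP v)).
apply: (@le_of_eq_norm R V comb (fun v w => ip (sval v) (sval w)) T' A' (K + K')
   _ _ _ _ _ _ _ _ _ _ _ (exist _ u lu)) => /=.
- by move=> [v lv] [w lw]; exact: ipC.
- by move=> c [v lv] [w lw] [x lx]; exact: ip_lin.
- by move=> [v lv]; exact: ip_ge0.
- by move=> c [v lv] [w lw] [x lx] /=; rewrite Tlin // ip_lin //; exact: (Tl2 _).
- by move=> c [v lv] [w lw] [x lx] /=; rewrite Alin // ip_lin //; exact: (Al2 _).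
- by move=> [v lv] [w lw] /=; rewrite /ip (T_self_adjoint T_inv).
- by move=> [v lv] [w lw] /=; rewrite /ip l2_nonneg_self_adjoint.
- move=> [v lv] /=; apply: le_trans (TK _ lv) _.
  by rewrite ler_wpM2r ?ip_ge0 // lerDl.
- move=> [v lv] /=; apply: le_trans (AK _ lv) _.
  by rewrite ler_wpM2r ?ip_ge0 // lerDr.
- by move=> [v lv] /=; have := A0 v lv; rewrite lecE => /andP[].
(* Here |A v|^2 = <v, A A v> = <v, S T v> = |T v|^2. Since [l2_adjoint] has [S] in the left
   argument, the products are conjugated twice. *)
- move=> [v lv] /=; rewrite /ip -(l2_nonneg_self_adjoint bA A0 lv (Al2 _ lv)).
  rewrite AA // (l2_dotC (Sl2 _ (Tl2 _ lv)) lv) (TS _ _ (Tl2 _ lv) lv).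
  by rewrite -(l2_dotC (Tl2 _ lv) (Tl2 _ lv)).
Qed.

Lemma trace_bound : l2_trace_class T ->
  exists tau, forall n, \sum_(0 <= k < n) P0 a b k * W0 T k <= tau.
Proof.
move=> [_ [A absA trA]].
have dA k : 0 <= complex.Re (l2_dot (l2_basis k) (A (l2_basis k))).
  have [_ A0 _] := absA.
  by have := A0 _ (l2_basis_l2 k); rewrite lecE => /andP[].
set s := (\sum_(0 <= n <oo) _)%E in trA.
have s0 : (0 <= s)%E by apply: nneseries_ge0 => k _ _; rewrite lee_fin.
exists (fine s) => n; rewrite -lee_fin fineK ?ge0_fin_numE //.
rewrite -sumEFin; apply: le_trans; last first.
  by apply: (nneseries_lim_ge n) => k _; rewrite lee_fin.
apply: lee_sum => k _; rewrite lee_fin.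
have := le_absolute_value absA (l2_basis_l2 k).
by rewrite /ip {1}l2_dot_basis (T_basisE a_gt0 T_inv J_pos) leqnn.
Qed.

End TraceBound.

(** * Solutions of the recurrence *)

(** The product [B] satisfies the assumed inequality with equality, hence dominates [y] by strong
    induction; each factor 1 + x is at most exp x. *)
Lemma discrete_gronwall (R : realType) (C c tau : R) (G y : nat -> R) :
  0 <= C -> 0 <= c -> (forall k, 0 <= G k) ->
  (forall n, \sum_(0 <= k < n) G k <= tau) ->
  (forall n, y n <= C + c * \sum_(0 <= k < n) G k * y k) ->
  forall n, y n <= C * expR (c * tau).
Proof.
move=> C0 c0 G0 Gtau h.
pose B n := C * \prod_(0 <= k < n) (1 + c * G k).
have Bge n : y n <= B n.
  have sumB m : C + c * \sum_(0 <= k < m) G k * B k = B m.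
    elim: m => [|m IH]; first by rewrite /B !big_geq // mulr0 addr0 mulr1.
    by rewrite big_nat_recr //= mulrDr addrA IH /B big_nat_recr //=; ring.
  have [m] := ubnP n; elim: m n => // m IH n; rewrite ltnS => nm.
  apply: le_trans (h n) _; rewrite -[leRHS]sumB lerD2l ler_wpM2l //.
  apply: ler_sum_nat => k /andP[_ kn]; rewrite ler_wpM2l // IH //.
  exact: leq_trans kn nm.
move=> n; apply: le_trans (Bge n) _; rewrite ler_wpM2l //.
apply: (@le_trans _ _ (expR (c * \sum_(0 <= k < n) G k))); last first.
  by rewrite ler_expR ler_wpM2l.
elim: n => [|n IH]; first by rewrite !big_geq // mulr0 expR0.
rewrite !big_nat_recr //= [c * (_ + _)]mulrDr expRD ler_pM ?expR_ge1Dx //.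
  by apply: prodr_ge0 => k _; rewrite addr_ge0 // mulr_ge0.
by rewrite addr_ge0 // mulr_ge0.
Qed.

Section JacobiSolutions.
Context {R : realType}.
Variables (a b P w : nat -> R) (tau : R).
Local Notation jact := (jacobi_action a b).
Hypothesis a_gt0 : forall n, 0 < a n.
Hypothesis P_0 : P 0 = 1.
Hypothesis P_act : forall n, jact (fun k => (P k)%:C) n = 0.
Hypothesis w_act : forall n, jact (fun k => (w k)%:C) n = l2_basis 0 n.
Hypothesis Pw_gt0 : forall n, 0 < P n * w n.
Hypothesis PP_lt0 : forall n, P n * P n.+1 < 0.
Hypothesis wP_wronskian : forall n, a n * (w n.+1 * P n - w n * P n.+1) = 1.
Hypothesis trace_le : forall n, \sum_(0 <= k < n) P k * w k <= tau.
Hypothesis P_not_l2 : ~ l2 (fun n => (P n)%:C : R[i]).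
Implicit Types (f : nat -> R[i]) (z kap : R[i]).

(** The source [kap] affects row 0 only: it is 0 for the first kind, 1 for the second kind, and
    [charD z] for the combination [psi] behind the resolvent. *)
Definition jacobi_solution z kap f :=
  forall n, jact f n = z * f n + kap * l2_basis 0 n.

Let g n := w n / P n.
Let G n := P n * w n.

Let P_neq0 n : P n != 0.
Proof. by apply/eqP => h; have := Pw_gt0 n; rewrite h mul0r ltxx. Qed.

Let PC_neq0 n : (P n)%:C != 0.
Proof. by rewrite -[0]/(0%:C) (inj_eq (@complexI R)). Qed.

Let G_ge0 n : 0 <= G n. Proof. exact: (ltW (Pw_gt0 n)). Qed.

Let g_gt0 n : 0 < g n.
Proof.
have -> : g n = P n * w n / P n ^+ 2 by rewrite /g; field.
by rewrite divr_gt0 // exprn_even_gt0 //= P_neq0.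
Qed.

Let gP n : g n * P n ^+ 2 = G n.
Proof. by rewrite /g /G; field. Qed.

(** This is the Wronskian of [w] and [P] divided by [P n * P n.+1]; the alternating signs of [P]
    make it positive, so [g] decreases. *)
Let g_step n : g n - g n.+1 = - (a n * (P n * P n.+1))^-1.
Proof.
have -> : g n - g n.+1 = - (w n.+1 * P n - w n * P n.+1) / (P n * P n.+1).
  by rewrite /g; field; rewrite !P_neq0.
have -> : w n.+1 * P n - w n * P n.+1 = (a n)^-1.
  by apply: (mulfI (lt0r_neq0 (a_gt0 n))); rewrite wP_wronskian mulfV ?gt_eqF.
by rewrite mulNr [in RHS]invfM.
Qed.

Let g_le m n : (m <= n)%N -> g n <= g m.
Proof.
move/subnKC <-; elim: (n - m)%N => [|k IH]; first by rewrite addn0.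
apply: le_trans IH; rewrite addnS -subr_ge0 g_step oppr_ge0 invr_le0.
by rewrite pmulr_rle0 // ltW.
Qed.

Let g_0 : g 0 = w 0. Proof. by rewrite /g P_0 divr1. Qed.

(** If [g] stayed above [e], then [P k ^+ 2] would be at most [G k / e], and [P] would be in l2. *)
Let g_small e : 0 < e -> exists N, forall n, (N <= n)%N -> g n < e.
Proof.
move=> e0; apply: contrapT => h; apply: P_not_l2; apply/l2P.
exists (tau / e) => n; rewrite ler_pdivlMr //.
apply: le_trans (trace_le n); rewrite mulr_suml; apply: ler_sum => k _.
rewrite cmod_real real_normK ?num_real // -/(G k) -gP mulrC ler_wpM2r ?sqr_ge0 //.
rewrite leNgt; apply/negP => gk; apply: h; exists k => m km.
exact: le_lt_trans (g_le km) gk.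
Qed.

(** As in Kronecker's lemma, the sum is split at a fixed index: beyond it [g n * P k ^+ 2] is at
    most [G k], a small tail, and the finite head is killed by the decay of [g n]. *)
Let g_sumP_small e : 0 < e ->
  exists N, forall n, (N <= n)%N -> g n * \sum_(0 <= k < n) P k ^+ 2 < e.
Proof.
move=> e0; have e2 : 0 < e / 2 by lra.
have [m hm] := tail_small G_ge0 trace_le e2.
pose s := 1 + \sum_(0 <= k < m) P k ^+ 2.
have s0 : 0 < s by rewrite ltr_pwDl // sumr_nat_ge0 // => k; exact: sqr_ge0.
have [N hN] := g_small (divr_gt0 e2 s0).
exists (maxn m N) => n; rewrite geq_max => /andP[mn /hN gn].
rewrite (big_cat_nat (leq0n m) mn) /= mulrDr [ltRHS]splitr ltr_leD //.
  apply: le_lt_trans (_ : _ <= g n * s) _; first by rewrite ler_wpM2l ?(ltW (g_gt0 n)) // lerDr.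
  by rewrite -ltr_pdivlMr.
apply: le_trans (ltW (hm n)); rewrite mulr_sumr; apply: ler_sum_nat => k /andP[_ kn].
by rewrite -gP ler_wpM2r ?sqr_ge0 // g_le // ltnW.
Qed.

(** An off-diagonal entry of the kernel of T is at most the geometric mean of two diagonal entries,
    as for any positive kernel; here it follows from [g n <= g k]. *)
Lemma kernel_le k n : (k <= n)%N ->
  `|P k| * `|w n| <= Num.sqrt (P k * w k) * Num.sqrt (P n * w n).
Proof.
move=> kn; rewrite -sqrtrM ?(ltW (Pw_gt0 k)) // -normrM -sqrtr_sqr ler_wsqrtr //.
rewrite -/(G k) -/(G n) -!gP.
have -> : (P k * w n) ^+ 2 = g n * (P k ^+ 2 * (g n * P n ^+ 2)).
  by rewrite /g; field.
rewrite mulrA ler_wpM2r //; first by rewrite mulr_ge0 ?sqr_ge0 // (ltW (g_gt0 n)).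
by rewrite ler_wpM2r ?sqr_ge0 // g_le.
Qed.

Lemma solution_wronskianP z kap f n : jacobi_solution z kap f ->
  (a n)%:C * (f n.+1 * (P n)%:C - f n * (P n.+1)%:C) =
  z * (\sum_(0 <= k < n.+1) f k * (P k)%:C) + kap.
Proof.
move=> sf; rewrite -(green_finite a b f (fun k => (P k)%:C)).
under eq_bigr do rewrite P_act sf mulr0 subr0 mulrDl -mulrA.
rewrite big_split /= -mulr_sumr; congr (_ + _).
rewrite big_nat_recl //= /l2_basis eqxx P_0 !mulr1 big1 ?addr0 // => i _.
by rewrite mulr0 mul0r.
Qed.

Lemma solution_wronskianW z kap f n : jacobi_solution z kap f ->
  (a n)%:C * (f n.+1 * (w n)%:C - f n * (w n.+1)%:C) =
  z * (\sum_(0 <= k < n.+1) f k * (w k)%:C) + (kap * (w 0)%:C - f 0%N).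
Proof.
move=> sf; rewrite -(green_finite a b f (fun k => (w k)%:C)).
under eq_bigr do rewrite w_act sf mulrDl -mulrA -addrA.
rewrite big_split /= -mulr_sumr; congr (_ + _).
rewrite big_nat_recl //= /l2_basis eqxx !mulr1 big1 ?addr0 // => i _.
by rewrite !mulr0 mul0r subr0.
Qed.

(** Variation of constants by Cramer's rule: the two preceding formulas give the Wronskians of [f]
    with [P] and with [w], and that of [w] and [P] is 1. *)
Lemma solution_repr z kap f n : jacobi_solution z kap f ->
  f n = (w n)%:C * (z * (\sum_(0 <= k < n.+1) f k * (P k)%:C) + kap)
      - (P n)%:C * (z * (\sum_(0 <= k < n.+1) f k * (w k)%:C) + (kap * (w 0)%:C - f 0%N)).
Proof.
move=> sf; rewrite -(solution_wronskianP n sf) -(solution_wronskianW n sf).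
have /(congr1 (real_complex R)) := wP_wronskian n.
rewrite rmorphM rmorphB !rmorphM rmorph1 /= => h.
by rewrite -[LHS]mulr1 -h; ring.
Qed.

Let phi f n : R[i] := f n / (P n)%:C.

Let phiP f n : f n = phi f n * (P n)%:C.
Proof. by rewrite /phi divfK. Qed.

(** A discrete Volterra equation. The term k = n of [solution_repr] cancels, which makes the sum
    strict, and the coefficients lie between [- G k] and 0 because [g n <= g k]; both facts are what
    Gronwall's inequality requires. *)
Let phi_repr z kap f n : jacobi_solution z kap f ->
  phi f n = f 0%N + kap * (g n - w 0)%:C
    + z * \sum_(0 <= k < n) (g n * P k ^+ 2 - G k)%:C * phi f k.
Proof.
move=> sf; rewrite {1}/phi {1}(solution_repr n sf).
have gE : (w n)%:C = (g n)%:C * (P n)%:C.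
  by rewrite -rmorphM /= /g divfK.
have e1 : \sum_(0 <= k < n) (g n * P k ^+ 2 - G k)%:C * phi f k =
  (g n)%:C * (\sum_(0 <= k < n.+1) f k * (P k)%:C) - \sum_(0 <= k < n.+1) f k * (w k)%:C.
  rewrite mulr_sumr -sumrB big_nat_recr //=.
  have -> : (g n)%:C * (f n * (P n)%:C) - f n * (w n)%:C = 0 by rewrite gE; ring.
  rewrite addr0; apply: eq_bigr => k _; rewrite [in RHS](phiP f k) rmorphB /G !rmorphM /=.
  by ring.
rewrite e1 gE rmorphB /=; field.
exact: PC_neq0.
Qed.

Lemma solution_growth z kap f n : jacobi_solution z kap f ->
  cmod (f n) <= (cmod (f 0%N) + cmod kap * w 0) * expR (cmod z * tau) * `|P n|.
Proof.
move=> sf; rewrite (phiP f n) cmodM cmod_real ler_wpM2r //.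
have w0 : 0 <= w 0 by rewrite -g_0 ltW.
apply: (@discrete_gronwall R _ _ _ G (fun m => cmod (phi f m))) => // [||m]; rewrite ?cmod_ge0 //.
  by rewrite addr_ge0 ?mulr_ge0 ?cmod_ge0.
rewrite (phi_repr m sf); apply: le_trans (cmodD _ _) _; apply: lerD.
  apply: le_trans (cmodD _ _) _; rewrite lerD2l cmodM ler_wpM2l ?cmod_ge0 //.
  rewrite cmod_real ler0_norm ?subr_le0 -g_0 ?g_le // opprB lerBlDr lerDl ltW //.
rewrite cmodM ler_wpM2l ?cmod_ge0 //; apply: le_trans (cmod_sum _ _ _) _.
apply: ler_sum_nat => k /andP[_ km]; rewrite cmodM ler_wpM2r ?cmod_ge0 //.
have h : g m * P k ^+ 2 <= G k by rewrite -gP ler_wpM2r ?sqr_ge0 // g_le // ltnW.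
have h0 : 0 <= g m * P k ^+ 2 by rewrite mulr_ge0 ?sqr_ge0 // ltW.
by rewrite cmod_real ler0_norm; lra.
Qed.

Let phi_bound z kap f : jacobi_solution z kap f ->
  exists2 M, 0 <= M & forall n, cmod (phi f n) <= M.
Proof.
move=> sf; exists ((cmod (f 0%N) + cmod kap * w 0) * expR (cmod z * tau)).
  rewrite mulr_ge0 ?expR_ge0 // addr_ge0 ?mulr_ge0 ?cmod_ge0 //.
  by rewrite -g_0 ltW.
move=> n; have := solution_growth n sf; rewrite {1}(phiP f n) cmodM cmod_real.
by rewrite ler_pM2r // normr_gt0.
Qed.

Let cmod_wf f k : cmod ((w k)%:C * f k) = G k * cmod (phi f k).
Proof.
have -> : (w k)%:C * f k = (G k)%:C * phi f k.
  by rewrite {1}(phiP f k) /G rmorphM /=; ring.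
by rewrite cmodM cmod_real ger0_norm.
Qed.

Lemma solution_abssum z kap f : jacobi_solution z kap f ->
  abssum (fun k => (w k)%:C * f k).
Proof.
move=> /phi_bound[M M0 hM]; exists (tau * M) => n.
apply: (@le_trans _ _ (\sum_(0 <= k < n) G k * M)).
  by apply: ler_sum => k _; rewrite cmod_wf ler_wpM2l.
by rewrite -mulr_suml ler_wpM2r.
Qed.

(* The limit of f n / P n; see solution_cvg. *)
Definition solution_limit z kap f : R[i] :=
  f 0%N - kap * (w 0)%:C - z * csum (fun k => (w k)%:C * f k).

(** Apart from the limit, each term carries a factor [g n] or is a tail of an absolutely convergent
    series; both the convergence and the decay estimate start from this form. *)
Let phi_limit_repr z kap f n : jacobi_solution z kap f ->
  phi f n = solution_limit z kap f + (g n)%:C * kap +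
   z * ((g n)%:C * \sum_(0 <= k < n) (P k ^+ 2)%:C * phi f k +
        (csum (fun k => (w k)%:C * f k) - \sum_(0 <= k < n) (w k)%:C * f k)).
Proof.
move=> sf; rewrite (phi_repr n sf) /solution_limit.
have -> : \sum_(0 <= k < n) (g n * P k ^+ 2 - G k)%:C * phi f k =
   (g n)%:C * (\sum_(0 <= k < n) (P k ^+ 2)%:C * phi f k) - \sum_(0 <= k < n) (w k)%:C * f k.
  rewrite mulr_sumr -sumrB; apply: eq_bigr => k _.
  by rewrite [in RHS](phiP f k) rmorphB /G !rmorphM /=; ring.
by rewrite rmorphB /=; ring.
Qed.

Lemma solution_cvg z kap f : jacobi_solution z kap f ->
  ccvg (fun n => f n / (P n)%:C) (solution_limit z kap f).
Proof.
move=> sf; have [M M0 hM] := phi_bound sf.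
pose K := 1 + cmod kap + cmod z * M.
have zM : 0 <= cmod z * M by rewrite mulr_ge0 ?cmod_ge0.
have K0 : 0 < K by rewrite /K; have := cmod_ge0 kap; lra.
move=> e e0; pose d := e / 3 / K.
have d0 : 0 < d by rewrite !divr_gt0.
have [N1 h1] := g_small d0; have [N2 h2] := g_sumP_small d0.
have [N3 h3] := tail_small G_ge0 trace_le d0.
exists (maxn N1 (maxn N2 N3)) => n; rewrite !geq_max => /and3P[/h1 g1 /h2 g2 nN3].
rewrite -/(phi f n) (phi_limit_repr n sf).
have cancel (l x x' : R[i]) : l + x + x' - l = x + x' by ring.
rewrite {}cancel; apply: le_lt_trans (cmodD _ _) _; rewrite !cmodM cmod_real ger0_norm ?(ltW (g_gt0 n)) //.
have t1 : cmod ((g n)%:C * \sum_(0 <= k < n) (P k ^+ 2)%:C * phi f k) <= M * d.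
  rewrite cmodM cmod_real ger0_norm ?(ltW (g_gt0 n)) //.
  apply: (@le_trans _ _ (g n * (\sum_(0 <= k < n) P k ^+ 2 * M))).
    rewrite ler_wpM2l ?(ltW (g_gt0 n)) //; apply: le_trans (cmod_sum _ _ _) _.
    apply: ler_sum => k _; rewrite cmodM cmod_real ger0_norm ?sqr_ge0 //.
    by rewrite ler_wpM2l ?sqr_ge0.
  by rewrite -mulr_suml mulrA mulrC ler_wpM2l // ltW.
have t2 : cmod (csum (fun k => (w k)%:C * f k) - \sum_(0 <= k < n) (w k)%:C * f k) <= M * d.
  apply: csum_dist (solution_abssum sf) _ => N.
  apply: (@le_trans _ _ (\sum_(n <= k < N) M * G k)).
    by apply: ler_sum => k _; rewrite cmod_wf mulrC ler_wpM2r.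
  rewrite -mulr_sumr ler_wpM2l // ltW //; apply: le_lt_trans (h3 N).
  have [nN|Nn] := leqP n N; last by rewrite big_geq ?(ltnW Nn) // sumr_nat_ge0.
  by rewrite (big_cat_nat nN3 nN) /= lerDr sumr_nat_ge0.
have h : cmod z * cmod ((g n)%:C * \sum_(0 <= k < n) (P k ^+ 2)%:C * phi f k +
    (csum (fun k => (w k)%:C * f k) - \sum_(0 <= k < n) (w k)%:C * f k)) <= cmod z * (M * d + M * d).
  by rewrite ler_wpM2l ?cmod_ge0 // (le_trans (cmodD _ _)) // lerD.
have eE : e = 3 * (K * d) by rewrite /d; field; rewrite gt_eqF.
have hk : g n * cmod kap <= d * cmod kap by rewrite ler_wpM2r ?cmod_ge0 // ltW.
have dz : 0 <= d * (cmod z * M) by rewrite mulr_ge0 // ltW.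
have dk : 0 <= d * cmod kap by rewrite mulr_ge0 ?cmod_ge0 // ltW.
by rewrite eE /K; lra.
Qed.

(* The weights h k = max (g k) eps make the supremum of |phi k| / h k finite
   before decay is known; letting eps = g n at the end removes eps. *)
Lemma solution_decay z kap f : jacobi_solution z kap f ->
  solution_limit z kap f = 0 ->
  exists2 C, 0 <= C & forall n, cmod (f n) <= C * `|w n|.
Proof.
move=> sf L0; have [M M0 hM] := phi_bound sf.
suff [C C0 hC] : exists2 C, 0 <= C & forall n, cmod (phi f n) <= C * g n.
  exists C => // n; rewrite (phiP f n) cmodM cmod_real.
  have -> : `|w n| = g n * `|P n|.
    by rewrite -[g n](ger0_norm (ltW (g_gt0 n))) -normrM /g divfK.
  by rewrite mulrA ler_wpM2r.
pose c := cmod z; have c0 : 0 <= c by exact: cmod_ge0.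
pose y n := cmod (phi f n); have y0 n : 0 <= y n by exact: cmod_ge0.
(* Past the index obtained from this threshold, each of the two sums over late indices contributes
   at most a quarter of the assumed bound, so a constant [C] improves to [C / 2 + A]. The rest, from
   [kap] and the indices before [n0], carries the factor [g n] and is collected in [A]. *)
have eta0 : 0 < (4 * (c + 1))^-1 by rewrite invr_gt0; lra.
have [n0 hn0] := tail_small G_ge0 trace_le eta0.
pose A := cmod kap + c * \sum_(0 <= k < n0) P k ^+ 2 * y k.
have sumP0 : 0 <= \sum_(0 <= k < n0) P k ^+ 2 * y k.
  by apply: sumr_ge0 => k _; rewrite mulr_ge0 ?sqr_ge0.
have A0 : 0 <= A by rewrite addr_ge0 ?cmod_ge0 ?mulr_ge0.
have tail m N : (n0 <= m)%N -> c * \sum_(m <= k < N) G k <= 1 / 4.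
  move=> n0m; apply: (@le_trans _ _ (c * (4 * (c + 1))^-1)).
    rewrite ler_wpM2l // ltW //; apply: le_lt_trans (hn0 N).
    have [mN|Nm] := leqP m N; last by rewrite big_geq ?(ltnW Nm) // sumr_nat_ge0.
    by rewrite (big_cat_nat n0m mN) /= lerDr sumr_nat_ge0.
  by rewrite ler_pdivrMr; lra.
have step eps C : 0 < eps -> 0 <= C ->
    (forall k, (n0 <= k)%N -> y k <= C * Num.max (g k) eps) ->
    forall n, (n0 <= n)%N -> y n <= (C / 2 + A) * Num.max (g n) eps.
  move=> eps0 C0 hC n n0n; set h := Num.max (g n) eps.
  have gh : g n <= h by rewrite le_max lexx.
  have eh : eps <= h by rewrite le_max lexx orbT.
  have h0 : 0 <= h by apply: le_trans gh; exact: (ltW (g_gt0 n)).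
  have hk k : (n <= k)%N -> Num.max (g k) eps <= h.
    by move=> nk; rewrite ge_max eh andbT (le_trans _ gh) // g_le.
  have t2 : c * cmod (csum (fun k => (w k)%:C * f k) - \sum_(0 <= k < n) (w k)%:C * f k)
      <= C * h / 4.
    have [c_0|c_n0] := eqVneq c 0; first by rewrite c_0 mul0r divr_ge0 ?mulr_ge0.
    have c_gt0 : 0 < c by rewrite lt_def c_n0.
    rewrite -ler_pdivlMl //; apply: csum_dist (solution_abssum sf) _ => N.
    rewrite ler_pdivlMl //.
    apply: (@le_trans _ _ (c * \sum_(n <= k < N) (C * h) * G k)).
      rewrite ler_wpM2l //; apply: ler_sum_nat => k /andP[nk _].
      rewrite cmod_wf mulrC ler_wpM2r //.
      by apply: le_trans (hC k (leq_trans n0n nk)) _; rewrite ler_wpM2l // hk.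
    rewrite -mulr_sumr mulrCA; have := tail n N n0n.
    by move=> /(ler_wpM2l (mulr_ge0 C0 h0)); lra.
  have t1 : c * (g n * \sum_(n0 <= k < n) P k ^+ 2 * y k) <= C * h / 4.
    apply: (@le_trans _ _ (c * \sum_(n0 <= k < n) (C * h) * G k)).
      rewrite ler_wpM2l // mulr_sumr; apply: ler_sum_nat => k /andP[n0k kn].
      apply: (@le_trans _ _ (C * (g n * P k ^+ 2 * Num.max (g k) eps))).
        have -> : C * (g n * P k ^+ 2 * Num.max (g k) eps) =
          g n * (P k ^+ 2 * (C * Num.max (g k) eps)) by ring.
        by rewrite ler_wpM2l ?(ltW (g_gt0 n)) // ler_wpM2l ?sqr_ge0 // hC.
      rewrite -[C * h * _]mulrA ler_wpM2l // -gP.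
      have gnk : g n <= g k by apply: g_le; exact: ltnW.
      have Pk0 : 0 <= P k ^+ 2 by exact: sqr_ge0.
      (* If the weight at k is [eps], it is at most [h] and [g n] is replaced by [g k]; if it is
         [g k], it completes [G k] and [g n] is at most [h]. *)
      have [e1|e1] := leP (g k) eps.
        rewrite [leRHS]mulrC; apply: ler_pM => //.
          by rewrite mulr_ge0 // ltW.
        by rewrite ltW.
        by rewrite ler_wpM2r.
      rewrite -[leLHS]mulrA [P k ^+ 2 * _]mulrC; apply: ler_wpM2r => //.
      by rewrite mulr_ge0 // ltW.
    rewrite -mulr_sumr mulrCA; have := tail n0 n (leqnn _).
    by move=> /(ler_wpM2l (mulr_ge0 C0 h0)); lra.
  have -> : y n = cmod ((g n)%:C * kap + z * ((g n)%:C *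
      (\sum_(0 <= k < n) (P k ^+ 2)%:C * phi f k)) +
      z * (csum (fun k => (w k)%:C * f k) - \sum_(0 <= k < n) (w k)%:C * f k)).
    by rewrite /y (phi_limit_repr n sf) L0; congr cmod; ring.
  apply: le_trans (cmodD _ _) _; rewrite [cmod (z * (_ - _))]cmodM.
  have t0 : cmod ((g n)%:C * kap + z * ((g n)%:C *
      (\sum_(0 <= k < n) (P k ^+ 2)%:C * phi f k))) <=
      g n * A + c * (g n * \sum_(n0 <= k < n) P k ^+ 2 * y k).
    apply: le_trans (cmodD _ _) _; rewrite !cmodM cmod_real ger0_norm ?(ltW (g_gt0 n)) //.
    rewrite /A mulrDr -addrA lerD2l -/c.
    have -> : g n * (c * \sum_(0 <= k < n0) P k ^+ 2 * y k) +
      c * (g n * \sum_(n0 <= k < n) P k ^+ 2 * y k) =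
      c * (g n * \sum_(0 <= k < n) P k ^+ 2 * y k).
      by rewrite (big_cat_nat (leq0n n0) n0n) /=; ring.
    rewrite ler_wpM2l // ler_wpM2l ?(ltW (g_gt0 n)) //.
    apply: le_trans (cmod_sum _ _ _) _; apply: ler_sum => k _.
    by rewrite cmodM cmod_real ger0_norm ?sqr_ge0.
  have gA : g n * A <= h * A by rewrite ler_wpM2r.
  by rewrite -/c; lra.
have main n : (n0 <= n)%N -> y n <= 2 * A * g n.
  move=> n0n; have eps0 := g_gt0 n; set eps := g n in eps0 *.
  have h0 k : 0 < Num.max (g k) eps by rewrite lt_max eps0 orbT.
  pose S := [set y k / Num.max (g k) eps | k in [set k | (n0 <= k)%N]].
  have supS : has_sup S.
    split; first by exists (y n0 / Num.max (g n0) eps), n0 => /=.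
    exists (M / eps) => _ [k _ <-]; apply: ler_pM => //; first by rewrite invr_ge0 ltW.
      exact: hM.
    by rewrite lef_pV2 ?posrE // le_max lexx orbT.
  have yS k : (n0 <= k)%N -> y k <= sup S * Num.max (g k) eps.
    move=> n0k; rewrite -ler_pdivrMr //; apply: ub_le_sup; first by case: supS.
    by exists k.
  have S0 : 0 <= sup S.
    apply: (@le_trans _ _ (y n0 / Num.max (g n0) eps)); first by rewrite divr_ge0 // ltW.
    by apply: ub_le_sup; [case: supS|exists n0 => /=].
  have S2 : sup S <= sup S / 2 + A.
    apply: sup_le_ub; first by case: supS.
    by move=> _ [k /= n0k <-]; rewrite ler_pdivrMr //; apply: step eps0 S0 yS _ n0k.
  have S2A : sup S <= 2 * A by lra.
  apply: le_trans (yS n n0n) _; by rewrite /eps maxxx ler_wpM2r // (ltW (g_gt0 n)).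
have q0 k : 0 <= y k / g k by rewrite divr_ge0 // ltW.
exists (2 * A + \sum_(0 <= k < n0) y k / g k).
  by rewrite addr_ge0 ?mulr_ge0 // sumr_nat_ge0.
move=> n; have [n0n|nn0] := leqP n0 n.
  apply: le_trans (main n n0n) _; rewrite ler_wpM2r ?(ltW (g_gt0 n)) // lerDl.
  by rewrite sumr_nat_ge0.
rewrite -ler_pdivrMr // (big_cat_nat (leq0n n) (ltnW nn0)) /= (big_ltn nn0).
have := sumr_nat_ge0 0 n q0; have := sumr_nat_ge0 n.+1 n0 q0.
by rewrite /y in q0 *; have := mulr_ge0 (ler0n R 2) A0; lra.
Qed.

End JacobiSolutions.

(** * The spectrum *)

Section SpectralFunctions.
Context {R : realType}.
Variables a b : nat -> R.
Hypothesis a_gt0 : forall n, 0 < a n.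
Variable T : (nat -> R[i]) -> nat -> R[i].
Local Notation jact := (jacobi_action a b).
Local Notation J := (jacobi_op a b).
Local Notation P := (P0 a b).
Local Notation w := (W0 T).
Hypothesis T_inv : bounded_inverse J T.
Hypothesis J_pos : positive_definite J.
Variable tau : R.
Hypothesis trace_le : forall n, \sum_(0 <= k < n) P k * w k <= tau.
Implicit Types (f u v : nat -> R[i]) (z kap : R[i]).

Let Pact := P0_action b a_gt0.
Let Wact := W0_action a_gt0 T_inv J_pos.
Let PW := P0W0_gt0 a_gt0 T_inv J_pos.
Let PP := P0_alternate a_gt0 J_pos.
Let wron := W0P0_wronskian a_gt0 T_inv J_pos.
Let Pnl2 := P0_not_l2 a_gt0 T_inv.

Lemma jacobi_solution_cvg z kap f : jacobi_solution a b z kap f ->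
  ccvg (fun n => f n / (P n)%:C) (solution_limit w z kap f).
Proof. exact: (solution_cvg a_gt0 (P0_0 a b) Pact Wact PW PP wron trace_le Pnl2). Qed.

Lemma jacobi_solution_decay z kap f : jacobi_solution a b z kap f ->
  solution_limit w z kap f = 0 ->
  exists2 C, 0 <= C & forall n, cmod (f n) <= C * `|w n|.
Proof. exact: (solution_decay a_gt0 (P0_0 a b) Pact Wact PW PP wron trace_le). Qed.

Lemma jacobi_solution_growth z kap f n : jacobi_solution a b z kap f ->
  cmod (f n) <= (cmod (f 0%N) + cmod kap * w 0) * expR (cmod z * tau) * `|P n|.
Proof. exact: (solution_growth a_gt0 (P0_0 a b) Pact Wact PW PP wron trace_le). Qed.

Lemma jacobi_solution_abssum z kap f : jacobi_solution a b z kap f ->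
  abssum (fun k => (w k)%:C * f k).
Proof. exact: (solution_abssum a_gt0 (P0_0 a b) Pact Wact PW PP wron trace_le). Qed.

Definition second_kind z n : R[i] := (second_kind_poly a b n).[z].

(* charD z and - weylE z are the limits of p_n(z) / p_n(0) and q_n(z) / p_n(0). *)
Definition charD z : R[i] := solution_limit w z 0 (first_kind a b z).

Definition weylE z : R[i] := - solution_limit w z 1 (second_kind z).

Lemma first_kind_solution z : jacobi_solution a b z 0 (first_kind a b z).
Proof. by move=> n; rewrite first_kind_action // mul0r addr0. Qed.

Lemma second_kind_solution z : jacobi_solution a b z 1 (second_kind z).
Proof. by move=> n; rewrite /second_kind second_kind_action // mul1r. Qed.

Lemma solution_limit_lin z c kap kap' f f' :
  abssum (fun k => (w k)%:C * f k) -> abssum (fun k => (w k)%:C * f' k) ->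
  solution_limit w z (c * kap + kap') (fun n => c * f n + f' n) =
  c * solution_limit w z kap f + solution_limit w z kap' f'.
Proof.
move=> h h'; rewrite /solution_limit.
rewrite (_ : csum _ = csum (fun k => c * ((w k)%:C * f k) + (w k)%:C * f' k)).
  by rewrite csum_lin //; ring.
by apply: eq_csum => k; ring.
Qed.

Lemma W0_l2 : l2 (fun n => (w n)%:C : R[i]).
Proof.
have -> : (fun n => (w n)%:C : R[i]) = T (l2_basis 0).
  by apply/funext => k; rewrite (W0C a_gt0 T_inv J_pos).
exact: (T_l2 T_inv) (@l2_basis_l2 R 0).
Qed.

Lemma l2_decay f C : (forall n, cmod (f n) <= C * `|w n|) -> l2 f.
Proof.
move=> h; apply: (l2_le (c := C%:C)) W0_l2 => n.
rewrite cmodM !cmod_real; apply: le_trans (h n) _.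
by rewrite ler_wpM2r // ler_norm.
Qed.

Lemma charD_eq0_spectrum z : charD z = 0 -> spectrum J z.
Proof.
move=> D0 [S [bS hS]].
have [C C0 hC] := jacobi_solution_decay (first_kind_solution z) D0.
have lP := l2_decay hC; have lzP := l2Z z lP.
have h0 : op_shift J z (first_kind a b z) (fun=> 0).
  rewrite /op_shift; have [] := jacobi_op_max a_gt0 T_inv lP lzP.
    by move=> n; rewrite first_kind_action.
  by move=> h _; congr J : h; apply/funext => n; rewrite add0r.
have h1 : op_shift J z (fun=> 0) (fun=> 0).
  rewrite /op_shift; have l0 := @l2_0 R.
  have [] := jacobi_op_max a_gt0 T_inv l0 l0.
    by move=> [|n]; rewrite ?jacobi_action0 ?jacobi_actionS !mulr0 !addr0.
  by move=> h _; congr J : h; apply/funext => n; rewrite mulr0 addr0.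
have := (hS _ _ (@l2_0 R)).1 h0; rewrite -((hS _ _ (@l2_0 R)).1 h1).
by move=> /(congr1 (fun f => f 0%N)); rewrite first_kind0 => /eqP; rewrite oner_eq0.
Qed.

(** The sequence [u] is [u 0] times the first kind plus the second kind, and its limit against [P]
    is 0: entry 0 of u = T (e_0 + z u) is precisely that statement. Linearity of the limit gives the
    identity. *)
Lemma resolvent_solution z u : op_shift J z u (l2_basis 0) ->
  u 0%N * charD z = weylE z.
Proof.
move=> Ju; have [lu lv _] := Ju.
have ju n : jact u n = z * u n + 1 * l2_basis 0 n.
  by rewrite (jacobi_op_action Ju) mul1r addrC.
have uE n : u n = u 0%N * first_kind a b z n + second_kind z n.
  apply: (@jacobi_solution_unique _ a b a_gt0 u
     (fun k => u 0%N * first_kind a b z k + second_kind z k) z n) => //.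
    by rewrite first_kind0 /second_kind /= horner0 mulr1 addr0.
  move=> m _; rewrite ju jacobi_action_lin first_kind_action //.
  by rewrite /second_kind second_kind_action //; ring.
have L0 : solution_limit w z 1 u = 0.
  have uT : u = T (fun n => l2_basis 0 n + z * u n).
    by case: T_inv => _ h; apply/(h _ _ lv).
  have awu : abssum (fun k => (w k)%:C * u k) by exact: l2_abssum W0_l2 lu.
  have : u 0%N = (w 0)%:C + z * csum (fun k => (w k)%:C * u k).
    rewrite {1}uT (T_entry T_inv) //.
    rewrite (eq_csum (v := fun k => z * ((w k)%:C * u k) + (w k)%:C * l2_basis 0 k)).
      rewrite csum_lin ?csum_basis 1?addrC //.
      by apply: l2_abssum W0_l2 _; exact: l2_basis_l2.
    by move=> k; rewrite (W0C a_gt0 T_inv J_pos); ring.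
  by rewrite /solution_limit => ->; ring.
have := @solution_limit_lin z (u 0%N) 0 1 _ _
  (jacobi_solution_abssum (first_kind_solution z))
  (jacobi_solution_abssum (second_kind_solution z)).
rewrite mulr0 add0r -/(charD z).
have -> : (fun n => u 0%N * first_kind a b z n + second_kind z n) = u.
  by apply/funext => n; rewrite [RHS]uE.
rewrite L0 => /eqP; rewrite eq_sym addr_eq0 => /eqP ->.
by [].
Qed.

Section Resolvent.
Variable z : R[i].
Hypothesis D_neq0 : charD z != 0.
Let D := charD z.
Let p n := first_kind a b z n.
Let psi n := D * second_kind z n + weylE z * p n.

(** The integral operator with kernel [psi] at the larger index times [p] at the smaller one,
    divided by their Wronskian [D]; the part with k > n is written as the whole series minus a
    partial sum. *)
Definition green_op v n : R[i] :=
  D^-1 * (psi n * (\sum_(0 <= k < n.+1) p k * v k) +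
          p n * (csum (fun k => psi k * v k) - \sum_(0 <= k < n.+1) psi k * v k)).

Let psi_solution : jacobi_solution a b z D psi.
Proof.
move=> n; rewrite /psi jacobi_action_lin.
rewrite (_ : (fun k => weylE z * p k) = (fun k => weylE z * p k + 0)); last first.
  by apply/funext => k; rewrite addr0.
rewrite jacobi_action_lin first_kind_solution second_kind_solution.
have -> : jact (fun=> 0) n = 0.
  by case: n => [|n]; rewrite ?jacobi_action0 ?jacobi_actionS !mulr0 !addr0.
by rewrite /p; ring.
Qed.

(** The coefficients of [psi] are chosen so that its limit is - D E + E D = 0. *)
Let psi_decay : exists2 C, 0 <= C & forall n, cmod (psi n) <= C * `|w n|.
Proof.
apply: jacobi_solution_decay psi_solution _.
have := jacobi_solution_abssum (first_kind_solution z) => hp.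
have e1 : solution_limit w z 0 (fun n => weylE z * p n) = weylE z * D.
  rewrite /D /charD /solution_limit.
  rewrite (eq_csum (v := fun k => weylE z * ((w k)%:C * p k))); last by move=> k; ring.
  by rewrite csumZ // /p; ring.
have := @solution_limit_lin z D 1 0 (second_kind z) (fun n => weylE z * p n)
  (jacobi_solution_abssum (second_kind_solution z)).
rewrite mulr1 addr0 e1 => ->; first by rewrite /weylE; ring.
by apply: eq_abssum (abssumZ (weylE z) hp) => k; rewrite mulrCA.
Qed.

Let psi_l2 : l2 psi.
Proof. by have [C _ /l2_decay] := psi_decay. Qed.

Let psi_p_wronskian n : (a n)%:C * (psi n.+1 * p n - psi n * p n.+1) = D.
Proof.
rewrite -(green_finite a b psi p).
under eq_bigr => k _ do rewrite psi_solution first_kind_solution mul0r addr0.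
rewrite (eq_bigr (fun k => D * (l2_basis 0 k * p k))); last first.
  by move=> k _; rewrite /p; ring.
rewrite -mulr_sumr big_nat_recl //= /l2_basis eqxx mul1r /p first_kind0.
by rewrite big1 ?addr0 ?mulr1 // => i _; rewrite mul0r.
Qed.

Let green_op_action v n : l2 v -> jact (green_op v) n = z * green_op v n + v n.
Proof.
move=> lv; set V := csum (fun k => psi k * v k).
have psi_rec := psi_solution.
have p_rec : jacobi_solution a b z 0 p := first_kind_solution z.
case: n => [|n].
  have := psi_rec 0%N; have := p_rec 0%N.
  rewrite !jacobi_action0 /l2_basis eqxx => hp hpsi.
  rewrite /green_op -/V !big_nat_recr //= !big_geq // !add0r.
  have p00 : p 0%N = 1 by rewrite /p first_kind0.
  rewrite -[X in _ = _ + X](mulKf D_neq0).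
  rewrite -/D.
  have -> : z * (D^-1 * (psi 0%N * (p 0%N * v 0%N) + p 0%N * (V - psi 0%N * v 0%N))) +
     D^-1 * (D * v 0%N) = D^-1 * ((z * psi 0%N + D * 1) * v 0%N * p 0%N + (z * p 0%N + 0 * 1) * (V - psi 0%N * v 0%N)).
    by rewrite p00; ring.
  by rewrite -hp -hpsi p00; ring.
have := psi_rec n.+1; have := p_rec n.+1; have := psi_p_wronskian n.
rewrite !jacobi_actionS /l2_basis /= !mulr0 !addr0 => hw hp hpsi.
rewrite /green_op -/V !(big_nat_recr n.+2) //= !(big_nat_recr n.+1) //=.
set U := \sum_(0 <= k < n.+1) p k * v k; set S := \sum_(0 <= k < n.+1) psi k * v k.
rewrite -[X in _ = _ + X](mulKf D_neq0) -/D.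
have -> : z * (D^-1 * (psi n.+1 * (U + p n.+1 * v n.+1) + p n.+1 * (V - (S + psi n.+1 * v n.+1)))) +
   D^-1 * (D * v n.+1) = D^-1 * (z * psi n.+1 * (U + p n.+1 * v n.+1) +
      z * p n.+1 * (V - (S + psi n.+1 * v n.+1)) + D * v n.+1) by ring.
rewrite -hw -hp -hpsi; ring.
Qed.

(** By [kernel_le] the kernel is dominated by a multiple of [Num.sqrt (G n) * Num.sqrt (G k)], a
    kernel of rank one whose norm is at most a multiple of the trace. The factor 2 in [K1] counts
    the two triangles of the kernel. *)
Let green_op_bound : exists2 K, 0 <= K & forall v N, sq_le v N ->
  sq_le (green_op v) (K * N).
Proof.
have [C C0 hC] := psi_decay.
have [C' C'0 hC'] : exists2 C', 0 <= C' & forall n, cmod (p n) <= C' * `|P n|.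
  exists ((cmod (p 0%N) + cmod (0 : R[i]) * w 0) * expR (cmod z * tau)).
    by rewrite cmod0 mul0r addr0 mulr_ge0 ?cmod_ge0 ?expR_ge0.
  by move=> n; exact: jacobi_solution_growth (first_kind_solution z).
have tau0 : 0 <= tau by have := trace_le 0; rewrite big_geq.
pose G k := P k * w k; have G0 k : 0 <= G k by exact: (ltW (PW k)).
pose K1 := cmod D^-1 * (2 * (C * C')).
have K10 : 0 <= K1 by rewrite mulr_ge0 ?cmod_ge0 // mulr_ge0 // mulr_ge0.
exists (K1 ^+ 2 * tau * tau).
  by rewrite mulr_ge0 // mulr_ge0 // sqr_ge0.
move=> v N hN; have N0 := sq_le_ge0 hN.
pose S := Num.sqrt tau * Num.sqrt N.
have S0 : 0 <= S by rewrite mulr_ge0 ?sqrtr_ge0.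
have sumS m n : \sum_(m <= k < n) Num.sqrt (G k) * cmod (v k) <= S.
  apply: cauchy_schwarz_sqrt => //.
    under eq_bigr do rewrite sqr_sqrtr //.
    exact: (sum_tail_le m n G0 trace_le).
  exact: (sum_tail_le m n (fun k => sqr_ge0 _) hN).
have kern := kernel_le a_gt0 PW PP wron.
have Pn0 n : 0 < `|P n|.
  by rewrite normr_gt0; apply/eqP => h; have := PW n; rewrite h mul0r ltxx.
have CC0 : 0 <= C * C' by exact: mulr_ge0.
have CCs0 n : 0 <= C * C' * Num.sqrt (G n) by rewrite mulr_ge0 ?sqrtr_ge0.
have Cs0 n : 0 <= C * Num.sqrt (G n) / `|P n|.
  by rewrite divr_ge0 // mulr_ge0 ?sqrtr_ge0.
have bound n : cmod (green_op v n) <= K1 * S * Num.sqrt (G n).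
  have -> : K1 * S * Num.sqrt (G n) = cmod D^-1 *
      (C * C' * Num.sqrt (G n) * S + C * C' * Num.sqrt (G n) * S).
    by rewrite /K1; ring.
  rewrite /green_op cmodM ler_wpM2l ?cmod_ge0 //.
  apply: le_trans (cmodD _ _) _; rewrite !cmodM.
  apply: lerD.
    apply: (@le_trans _ _ (\sum_(0 <= k < n.+1)
       C * C' * Num.sqrt (G n) * (Num.sqrt (G k) * cmod (v k)))); last first.
      by rewrite -mulr_sumr ler_wpM2l.
    apply: le_trans (ler_wpM2l (cmod_ge0 _) (cmod_sum _ _ _)) _.
    rewrite mulr_sumr; apply: ler_sum_nat => k /andP[_]; rewrite ltnS => kn.
    rewrite cmodM !mulrA ler_wpM2r ?cmod_ge0 //.
    apply: (@le_trans _ _ ((C * `|w n|) * (C' * `|P k|))).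
      by apply: ler_pM; rewrite ?cmod_ge0.
    have -> : C * `|w n| * (C' * `|P k|) = C * C' * (`|P k| * `|w n|) by ring.
    rewrite -[leRHS]mulrA ler_wpM2l ?mulr_ge0 // [leRHS]mulrC.
    exact: kern.
  (* For k > n, [kernel_le] divided by [|P n|] bounds [w k], hence [psi k]; the bound [C' * |P n|]
     for [p n] restores the factor. *)
  apply: (@le_trans _ _ (C' * `|P n| * (C * Num.sqrt (G n) / `|P n| * S))); last first.
    rewrite le_eqVlt; apply/orP; left; apply/eqP; field.
    by rewrite gt_eqF.
  apply: ler_pM; rewrite ?cmod_ge0 //.
  apply: csum_dist => [|m].
    by apply: l2_abssum psi_l2 _; apply/l2P; exists N.
  apply: (@le_trans _ _ (\sum_(n.+1 <= k < m) C * Num.sqrt (G n) / `|P n| *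
     (Num.sqrt (G k) * cmod (v k)))); last first.
    by rewrite -mulr_sumr ler_wpM2l.
  apply: ler_sum_nat => k /andP[nk _]; rewrite cmodM mulrA ler_wpM2r ?cmod_ge0 //.
  apply: le_trans (hC k) _.
  have -> : C * Num.sqrt (G n) / `|P n| * Num.sqrt (G k) =
      C * (Num.sqrt (G n) * Num.sqrt (G k) / `|P n|) by ring.
  by rewrite ler_wpM2l // ler_pdivlMr // mulrC; exact: kern (ltnW nk).
move=> m; apply: (@le_trans _ _ (\sum_(0 <= k < m) (K1 * S) ^+ 2 * G k)).
  apply: ler_sum => k _; rewrite -[X in _ * X](sqr_sqrtr (G0 k)) -exprMn.
  have KS0 : 0 <= K1 * S * Num.sqrt (G k) by rewrite mulr_ge0 ?sqrtr_ge0 // mulr_ge0.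
  by rewrite ler_sqr ?nnegrE ?cmod_ge0.
have -> : (K1 * S) ^+ 2 = K1 ^+ 2 * (Num.sqrt tau ^+ 2 * Num.sqrt N ^+ 2).
  by rewrite /S; ring.
rewrite -mulr_sumr !sqr_sqrtr //.
apply: (@le_trans _ _ (K1 ^+ 2 * (tau * N) * tau)).
  by rewrite ler_wpM2l // mulr_ge0 ?sqr_ge0 // mulr_ge0.
by rewrite le_eqVlt; apply/orP; left; apply/eqP; ring.
Qed.

Let green_op_l2 v : l2 v -> l2 (green_op v).
Proof.
by have [K _ h] := green_op_bound; move=> /l2P[N /h hN]; apply/l2P; eexists; exact: hN.
Qed.

Let green_op_bounded : l2_bounded green_op.
Proof.
split; first exact: green_op_l2.
  move=> c u v lu lv; apply/funext => n; rewrite /green_op.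
  rewrite (eq_csum (v := fun k => c * (psi k * u k) + psi k * v k)); last by move=> k; ring.
  rewrite csum_lin; try exact: l2_abssum.
  have e (q : nat -> R[i]) : \sum_(0 <= k < n.+1) q k * (c * u k + v k) =
     c * (\sum_(0 <= k < n.+1) q k * u k) + \sum_(0 <= k < n.+1) q k * v k.
    by rewrite mulr_sumr -big_split /=; apply: eq_bigr => k _; ring.
  by rewrite !e; ring.
have [K K0 h] := green_op_bound; exists K => u lu.
have h0 : (0 <= l2_sqnorm u)%E.
  by apply: nneseries_ge0 => k _ _; rewrite lee_fin sqr_ge0.
have uE : l2_sqnorm u = (fine (l2_sqnorm u))%:E.
  by rewrite fineK // ge0_fin_numE.
rewrite uE -EFinM; apply/sq_le_sqnorm/h/sq_le_sqnorm.
by rewrite -uE.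
Qed.

Lemma charD_neq0_resolvent : resolvent_set J z.
Proof.
exists green_op; split; first exact: green_op_bounded.
move=> u v lv; have lg := green_op_l2 lv; split=> [Ju|->]; last first.
  have lvg : l2 (fun n => v n + z * green_op v n) by apply: l2D => //; exact: l2Z.
  have [] // := jacobi_op_max a_gt0 T_inv lg lvg.
  by move=> n; rewrite green_op_action // addrC.
have [lu _ _] := Ju.
pose d n := u n - green_op v n.
have ld : l2 d.
  have := l2_lin (-1) lg lu.
  by congr l2; apply/funext => n; rewrite /d; ring.
have jd n : jact d n = z * d n.
  by rewrite /d jacobi_actionB (jacobi_op_action Ju) green_op_action //; ring.
have [_ dT] := jacobi_op_max a_gt0 T_inv ld (l2Z z ld) jd.
have dE n : d n = d 0%N * p n.
  by apply: (@jacobi_eigen_unique _ a b a_gt0 d z n) => // m _; exact: jd.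
(* The difference is [d 0] times [p] and also equals T (z d); entry 0 of the latter says d_0 = z d_0
   (sum of w_k p_k), which is d_0 D = 0. *)
have : d 0%N * D = 0.
  have awd : abssum (fun k => (w k)%:C * d k) by exact: l2_abssum W0_l2 ld.
  have e1 : d 0%N = z * csum (fun k => (w k)%:C * d k).
    rewrite {1}dT (T_entry T_inv); last exact: l2Z.
    rewrite -csumZ //; apply: eq_csum => k.
    by rewrite (W0C a_gt0 T_inv J_pos); ring.
  have e2 : csum (fun k => (w k)%:C * d k) = d 0%N * csum (fun k => (w k)%:C * p k).
    rewrite -csumZ; last exact: jacobi_solution_abssum (first_kind_solution z).
    by apply: eq_csum => k; rewrite dE; ring.
  rewrite /D /charD /solution_limit first_kind0 mul0r subr0 mulrBr mulr1 mulrCA.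
  by rewrite -/p -e2 -e1 subrr.
move=> /eqP; rewrite mulf_eq0 (negbTE D_neq0) orbF => /eqP d0.
by apply/funext => n; apply/eqP; rewrite -subr_eq0 -/(d n) dE d0 mul0r.
Qed.

End Resolvent.

Lemma spectrumP z : spectrum J z <-> charD z = 0.
Proof.
split=> [h|]; last exact: charD_eq0_spectrum.
by apply: contrapT => /eqP /charD_neq0_resolvent.
Qed.

Lemma second_kind_fun_charD z : resolvent_set J z ->
  second_kind_fun a b 0 z * charD z = weylE z.
Proof.
move=> hz; rewrite /second_kind_fun l2_dot_basis; apply: resolvent_solution.
have [_ h] : bounded_inverse (op_shift J z) (resolvent J z) by apply: xgetPex.
by apply/(h _ _ (@l2_basis_l2 R 0)).
Qed.

Lemma second_kind_fun0 n : second_kind_fun a b n 0 = (w n)%:C.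
Proof.
rewrite /second_kind_fun l2_dot_basis -(W0C a_gt0 T_inv J_pos).
have e u v : op_shift J 0 u v = J u v.
  by rewrite /op_shift; congr J; apply/funext => k; rewrite mul0r addr0.
have [_ h] : bounded_inverse (op_shift J 0) (resolvent J 0).
  apply: xgetPex; exists T; case: T_inv => bT hT; split=> // u v.
  by rewrite e; exact: hT.
congr (_ n); apply/esym/(h _ _ (@l2_basis_l2 R 0)); rewrite e.
by apply: (T_jacobi T_inv); exact: l2_basis_l2.
Qed.

(** The term of index 0 vanishes because the polynomial of the second kind of index 0 is 0. *)
Lemma second_kind_seriesE z :
  second_kind_series a b z = series (fun k => (w k)%:C * second_kind z k).
Proof.
apply/funext => -[|N]; rewrite /second_kind_series /series /=; first by rewrite !big_geq.
rewrite [RHS]big_ltn // {1}/second_kind /= horner0 mulr0 add0r.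
by apply: eq_bigr => k _; rewrite second_kind_fun0.
Qed.

Lemma weylE_series z :
  weylE z = second_kind_fun a b 0 0 + z * limn (second_kind_series a b z).
Proof.
rewrite second_kind_seriesE second_kind_fun0 -/(csum _).
by rewrite /weylE /solution_limit /second_kind /= horner0; ring.
Qed.

End SpectralFunctions.

(** * Interlacing *)

Section Interlacing.
Context {R : realType}.
Variables a b : nat -> R.
Hypothesis a_gt0 : forall n, 0 < a n.
Local Notation pol := (first_kind_poly a b).
Hypothesis P_alt : forall n, (pol n).[0] * (pol n.+1).[0] < 0.
Implicit Types (r s t : nat -> R).

Lemma first_kind_size n :
  size (pol n) = n.+1 /\ 0 < lead_coef (pol n).
Proof.
have step c d (p q : {poly R}) m : 0 < c -> size p = m.+1 -> 0 < lead_coef p ->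
    (size q <= m.+1)%N ->
    size (c^-1 *: (('X - d%:P) * p - q)) = m.+2 /\
    0 < lead_coef (c^-1 *: (('X - d%:P) * p - q)).
  move=> c0 sp lp sq.
  have p0 : p != 0 by rewrite -size_poly_eq0 sp.
  have ss : size (('X - d%:P) * p) = m.+2.
    by rewrite size_monicM ?monicXsubC // size_XsubC sp.
  rewrite size_scale ?invr_neq0 ?gt_eqF // lead_coefZ.
  rewrite size_polyDl ?lead_coefDl ?ss ?size_polyN ?ltnS //.
  by rewrite lead_coef_monicM ?monicXsubC // mulr_gt0 // invr_gt0.
have [] : (size (pol n) = n.+1 /\ 0 < lead_coef (pol n)) /\
    (size (pol n.+1) = n.+2 /\ 0 < lead_coef (pol n.+1)); last by [].
elim: n => [|n [[s1 l1] [s2 l2]]].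
  split; first by rewrite /= size_poly1 lead_coef1.
  by apply: step => //=; rewrite ?size_poly1 ?lead_coef1 ?size_poly0.
split=> //; rewrite [pol n.+2]/((a n.+1)^-1 *: (('X - (b n.+1)%:P) * pol n.+1 - a n *: pol n)).
by apply: step => //; rewrite size_scale ?gt_eqF // s1.
Qed.

Definition poly_roots n r :=
  pol n = lead_coef (pol n) *: \prod_(0 <= j < n) ('X - (r j)%:P).

Lemma poly_rootsE n r x : poly_roots n r ->
  (pol n).[x] = lead_coef (pol n) * \prod_(0 <= j < n) (x - r j).
Proof.
move=> h; rewrite [in LHS]h hornerZ horner_prod; congr (_ * _).
by apply: eq_bigr => j _; rewrite hornerXsubC.
Qed.

(** Exactly n - k factors are negative; n + k has the same parity and avoids the truncated
    subtraction. *)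
Lemma sign_prod_sub n k r x : (k <= n)%N ->
  (forall j, (j < k)%N -> r j < x) -> (forall j, (k <= j < n)%N -> x < r j) ->
  0 < (-1) ^+ (n + k) * \prod_(0 <= j < n) (x - r j).
Proof.
move=> kn hl hr; rewrite (big_cat_nat (leq0n k) kn) /=.
have -> : \prod_(k <= j < n) (x - r j) = (-1) ^+ (n - k) * \prod_(k <= j < n) (r j - x).
  rewrite -(subnKC kn) addKn; elim: (n - k)%N => [|m IH].
    by rewrite addn0 !big_geq // mul1r.
  by rewrite addnS !big_nat_recr ?leq_addr //= IH exprS; ring.
have e : (-1) ^+ (n + k) * (-1) ^+ (n - k) = 1 :> R.
  rewrite -exprD (_ : n + k + (n - k) = n * 2)%N; last by lia.
  by rewrite exprM sqrr_sign.
have assoc (u v p q : R) : u * (p * (v * q)) = u * v * (p * q) by ring.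
rewrite assoc e mul1r; apply: mulr_gt0.
  by rewrite big_nat; apply: prodr_gt0 => j /andP[_ /hl]; rewrite subr_gt0.
by rewrite big_nat; apply: prodr_gt0 => j /hr; rewrite subr_gt0.
Qed.

Definition interlaced n r s :=
  [/\ forall j, (j < n)%N -> s j < r j /\ r j < s j.+1, 0 < s 0,
      poly_roots n r & poly_roots n.+1 s].

Lemma pol_sign0 n : 0 < (-1) ^+ n * (pol n).[0].
Proof.
elim: n => [|n IH]; first by rewrite mul1r /= hornerE.
rewrite exprS mulN1r mulNr oppr_gt0.
have : (-1) ^+ n * (pol n).[0] * ((-1) ^+ n * (pol n.+1).[0]) < 0.
  have -> : (-1) ^+ n * (pol n).[0] * ((-1) ^+ n * (pol n.+1).[0]) =
     ((-1) ^+ n) ^+ 2 * ((pol n).[0] * (pol n.+1).[0]) by ring.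
  by rewrite sqrr_sign mul1r.
by rewrite pmulr_rlt0.
Qed.

Lemma interlaced_lt n r s i j : interlaced n r s -> (i < j <= n)%N -> s i < s j.
Proof.
move=> [h _ _ _]; elim: j => // j IH /andP[]; rewrite ltnS leq_eqVlt => ij jn.
have [s1 s2] := h j jn; have sj := lt_trans s1 s2.
by case/predU1P: ij => [->//|ij]; apply: lt_trans sj; rewrite IH // ij ltnW.
Qed.

(* Between consecutive zeros of P_(n+1) the three term recurrence makes P_(n+2)
   change sign; positivity of the least zero comes from the sign at 0. *)
Lemma interlaced_next n r s : interlaced n r s -> exists t, interlaced n.+1 s t.
Proof.
move=> il; have [h s0 pr ps] := il.
have [sz l2] := first_kind_size n.+2; have [_ l0] := first_kind_size n.
have [big hbig] := poly_pinfty_gt_lc l2.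
(* The n + 3 points 0, s_0, ..., s_n and one far to the right, where the leading coefficient
   dictates the sign, separate the n + 2 roots sought. *)
pose y i := if i is j.+1 then (if (j <= n)%N then s j else Num.max big (s n + 1)) else 0.
have y_sgn i : (i <= n.+2)%N -> 0 < (-1) ^+ (n + i) * (pol n.+2).[y i].
  case: i => [_|i].
    have := pol_sign0 n.+2; rewrite /y addn0.
    by rewrite -addn2 exprD sqrrN expr1n mulr1.
  rewrite ltnS /y => ni; case: leqP => [jn|nj]; last first.
    have -> : i = n.+1 by apply/eqP; rewrite eqn_leq ni.
    rewrite addnS addnS addnn -addn2 exprD sqrrN expr1n mulr1 -muln2 mulnC exprM sqrrN expr1n expr1n mul1r.
    by apply: lt_le_trans l2 _; apply: hbig; rewrite le_max lexx.
  have root_s : (pol n.+1).[s i] = 0.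
    have jn' : (i < n.+1)%N by [].
    rewrite (poly_rootsE _ ps) (big_cat_nat (leq0n i) (leqW jn)) /= (big_ltn jn').
    by rewrite subrr mul0r !mulr0.
  have e : a n.+1 * (pol n.+2).[s i] = - (a n * (pol n).[s i]).
    have := first_kind_polyS b a_gt0 n; move: root_s.
    move: (pol n) (pol n.+1) (pol n.+2) => p0 p1 p2 p1s.
    move=> /(congr1 (fun p : {poly R} => p.[s i])).
    by rewrite !hornerE p1s mulr0 sub0r.
  rewrite -(pmulr_rgt0 _ (a_gt0 n.+1)) mulrCA e addnS exprS mulN1r mulNr mulrN opprK.
  rewrite mulrCA pmulr_rgt0 // (poly_rootsE _ pr) mulrCA pmulr_rgt0 //.
  apply: sign_prod_sub => // j.
    move=> ji; have [_ rj] := h j (leq_trans ji jn).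
    move: ji; rewrite leq_eqVlt => /predU1P[<-//|ji].
    by apply: lt_trans rj _; apply: (interlaced_lt il); rewrite ji.
  move=> /andP[ij jn']; have [sj _] := h j jn'.
  move: ij; rewrite leq_eqVlt => /predU1P[->//|ij].
  by apply: lt_trans sj; apply: (interlaced_lt il); rewrite ij ltnW.
have y_lt i : (i <= n.+1)%N -> y i < y i.+1.
  rewrite /y; case: i => [_|i]; first by rewrite leq0n.
  rewrite ltnS => ni; rewrite ni; case: (leqP i.+1 n) => ni'.
    by apply: (interlaced_lt il); rewrite ltnSn.
  have -> : i = n by apply/eqP; rewrite eqn_leq ni.
  by rewrite lt_max ltrDl ltr01 orbT.
have [t ht] : {t : nat -> R & forall i, (i <= n.+1)%N ->
    [/\ y i < t i, t i < y i.+1 & root (pol n.+2) (t i)]}.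
  apply: (@choice nat R (fun i u => (i <= n.+1)%N -> [/\ y i < u, u < y i.+1 & root (pol n.+2) u])) => i.
  have [ni|ni] := leqP i n.+1; last by exists 0.
  have [||u] := @poly_ivtoo _ (pol n.+2) (y i) (y i.+1); first exact: (ltW (y_lt i ni)).
    have := y_sgn i (leqW ni); have := y_sgn i.+1 ni.
    rewrite addnS exprS mulN1r mulNr oppr_gt0 => h1 h2.
    have : (-1) ^+ (n + i) * (pol n.+2).[y i] * ((-1) ^+ (n + i) * (pol n.+2).[y i.+1]) < 0.
      by rewrite pmulr_rlt0.
    have -> : (-1) ^+ (n + i) * (pol n.+2).[y i] * ((-1) ^+ (n + i) * (pol n.+2).[y i.+1]) =
       ((-1) ^+ (n + i)) ^+ 2 * ((pol n.+2).[y i] * (pol n.+2).[y i.+1]) by ring.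
    by rewrite sqrr_sign mul1r.
  by rewrite in_itv /= => /andP[u1 u2] ru; exists u.
have t_lt i j : (i < j <= n.+1)%N -> t i < t j.
  elim: j => // j IH /andP[]; rewrite ltnS leq_eqVlt => ij jn.
  have [_ t1 _] := ht j (ltnW jn); have [t2 _ _] := ht j.+1 jn.
  have tj := lt_trans t1 t2.
  by case/predU1P: ij => [->//|ij]; apply: lt_trans tj; rewrite IH // ij ltnW.
exists t; split=> //.
- move=> j; rewrite ltnS => jn.
  have [_ t1 _] := ht j (leqW jn); have [t2 _ _] := ht j.+1 jn.
  by move: t1 t2; rewrite /= jn.
- by have [] := ht 0%N isT.
- rewrite /poly_roots [LHS](@all_roots_prod_XsubC _ _ (mkseq t n.+2)).
  + by rewrite big_map /index_iota subn0.
  + by rewrite sz size_mkseq.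
  + rewrite all_map; apply/allP => i; rewrite mem_iota add0n => /andP[_ ni] /=.
    by have [] := ht i ni.
  + rewrite uniq_rootsE map_inj_in_uniq ?iota_uniq // => i j.
    rewrite !mem_iota !add0n => /andP[_ ni] /andP[_ nj] tij.
    case: (ltngtP i j) => // ij.
      by have := t_lt i j; rewrite ij tij ltxx => /(_ nj).
    by have := t_lt j i; rewrite ij tij ltxx => /(_ ni).
Qed.

Lemma interlaced_roots : exists x : nat -> nat -> R, forall n, interlaced n (x n) (x n.+1).
Proof.
have step (p : nat * (nat -> R) * (nat -> R)) : exists t,
    interlaced p.1.1 p.1.2 p.2 -> interlaced p.1.1.+1 p.2 t.
  have [/interlaced_next[t ht]|nil] := pselect (interlaced p.1.1 p.1.2 p.2).
    by exists t.
  by exists p.2.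
have [F hF] := choice step.
(* The state holds two consecutive root sequences, since each step uses both. Initially the first is
   arbitrary, there being no root in degree 0, and the second starts with [b 0], the root in degree
   1. *)
pose fix st n : (nat -> R) * (nat -> R) :=
  if n is m.+1 then ((st m).2, F (m, (st m).1, (st m).2)) else (fun=> 0, fun=> b 0%N).
exists (fun n => (st n).1) => n; rewrite -[(st n.+1).1]/((st n).2).
elim: n => [|n IH]; last exact: (hF (n, (st n).1, (st n).2) IH).
have e1 : pol 1 = (a 0%N)^-1 *: ('X - (b 0%N)%:P) by rewrite /= mulr1 subr0.
split=> //=.
- have := P_alt 0; rewrite e1 /= hornerE mul1r hornerZ hornerXsubC sub0r mulrN oppr_lt0.
  by rewrite pmulr_rgt0 // invr_gt0.
- by rewrite /poly_roots big_geq //= lead_coef1 scale1r.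
- rewrite /poly_roots big_nat1 e1 lead_coefZ lead_coefXsubC mulr1.
  by [].
Qed.

(** The numbers [y n j] are reciprocals of the roots, padded with 0 for j >= n. Interlacing makes
    them increase with n, and the padding extends this to all n and j. *)
Lemma first_kind_factorization : exists y : nat -> nat -> R,
  [/\ forall n j, 0 <= y n j, forall n j, (j < n)%N -> 0 < y n j,
      forall n j, y n j <= y n.+1 j, forall n j, y n j.+1 <= y n j
    & forall n z, first_kind a b z n =
        ((pol n).[0])%:C * \prod_(0 <= j < n) (1 - z * (y n j)%:C)].
Proof.
have [x hx] := interlaced_roots.
have x_lt n i j : (i < j < n)%N -> x n i < x n j.
  case: n => [|n]; first by rewrite ltn0 andbF.
  by rewrite ltnS; exact: interlaced_lt (hx n).
have x_gt0 n j : (j < n)%N -> 0 < x n j.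
  case: n => // n jn; have [_ x0 _ _] := hx n.
  case: j jn => // j jn; apply: lt_trans x0 _.
  by apply: x_lt.
pose y n j := if (j < n)%N then (x n j)^-1 else 0.
have y_gt0 n j : (j < n)%N -> 0 < y n j.
  by move=> jn; rewrite /y jn invr_gt0 x_gt0.
have y_ge0 n j : 0 <= y n j.
  by have [/y_gt0/ltW//|nj] := ltnP j n; rewrite /y ltnNge nj.
exists y; split=> //.
- move=> n j; have [jn|nj] := ltnP j n; last by rewrite {1}/y ltnNge nj /= y_ge0.
  rewrite /y jn ltnS (ltnW jn) lef_pV2 ?posrE ?x_gt0 //; last exact: leqW.
  by have [h _ _ _] := hx n; have [/ltW] := h j jn.
- move=> n j; have [jn|nj] := ltnP j.+1 n; last by rewrite {1}/y ltnNge nj /= y_ge0.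
  rewrite /y jn (ltnW jn) lef_pV2 ?posrE ?x_gt0 //; last exact: ltnW.
  apply/ltW.
  by apply: x_lt; rewrite ltnSn.
move=> n z.
have pn : poly_roots n (x n) by have [_ _] := hx n.
rewrite /first_kind [in LHS]pn map_polyZ rmorph_prod /= hornerZ horner_prod.
rewrite (poly_rootsE 0 pn) rmorphM rmorph_prod /= -mulrA; congr (_ * _).
rewrite -big_split /=; apply: eq_big_nat => j /andP[_ jn].
rewrite rmorphB /= map_polyX map_polyC /= hornerXsubC sub0r /y jn.
have xC : (x n j)%:C != 0 by rewrite -[0]/(0%:C) (inj_eq (@complexI R)) gt_eqF // x_gt0.
by rewrite fmorphV rmorphN /=; field.
Qed.

End Interlacing.

(** * Products *)

Section Products.
Context {R : realType}.
Implicit Types (al : nat -> R[i]) (z : R[i]).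

Lemma cmod_prod_le al m n :
  cmod (\prod_(m <= j < n) (1 + al j)) <= expR (\sum_(m <= j < n) cmod (al j)).
Proof.
have [/subnKC <-|nm] := leqP m n; last by rewrite !big_geq ?(ltnW nm) // cmod1 expR0.
elim: (n - _)%N => [|k IH]; first by rewrite addn0 !big_geq // cmod1 expR0.
rewrite addnS !big_nat_recr ?leq_addr //= cmodM expRD ler_pM ?cmod_ge0 //.
by apply: le_trans (cmodD _ _) _; rewrite cmod1 expR_ge1Dx.
Qed.

Lemma cmod_prod_sub1 al m n :
  cmod (\prod_(m <= j < n) (1 + al j) - 1) <= expR (\sum_(m <= j < n) cmod (al j)) - 1.
Proof.
have [/subnKC <-|nm] := leqP m n; last first.
  by rewrite !big_geq ?(ltnW nm) // subrr cmod0 expR0 subrr.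
elim: (n - _)%N => [|k IH].
  by rewrite addn0 !big_geq // subrr cmod0 expR0 subrr.
rewrite addnS !big_nat_recr ?leq_addr //= expRD.
set N := (m + k)%N in IH *; set x := \prod_(_ <= _ < _) _ in IH *.
set s := \sum_(_ <= _ < _) _ in IH *.
have -> : x * (1 + al N) - 1 = (x - 1) + x * al N by ring.
apply: le_trans (cmodD _ _) _; rewrite cmodM.
have h1 := cmod_prod_le al m N; rewrite -/x -/s in h1.
have h2 := expR_ge1Dx (cmod (al N)); have h3 := expR_ge0 s.
have h4 : cmod x * cmod (al N) <= expR s * cmod (al N) by rewrite ler_wpM2r ?cmod_ge0.
have h5 : expR s * (1 + cmod (al N)) <= expR s * expR (cmod (al N)) by rewrite ler_wpM2l.
by lra.
Qed.

Lemma expR_sub1_small e : 0 < e -> exists2 d : R, 0 < d & forall x, x <= d -> expR x - 1 <= e.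
Proof.
move=> e0; exists (ln (1 + e)); first by rewrite ln_gt0 // ltrDl.
move=> x xd; rewrite lerBlDl -[leRHS]lnK ?ler_expR // posrE; lra.
Qed.

Lemma ccvg_prod (u : nat -> nat -> R[i]) (l : nat -> R[i]) m :
  (forall j, ccvg (fun n => u n j) (l j)) ->
  ccvg (fun n => \prod_(0 <= j < m) u n j) (\prod_(0 <= j < m) l j).
Proof.
move=> h; elim: m => [|m IH].
  by rewrite big_geq // => e e0; exists 0%N => n _; rewrite big_geq // subrr cmod0.
rewrite big_nat_recr //=.
have -> : (fun n => \prod_(0 <= j < m.+1) u n j) = (fun n => \prod_(0 <= j < m) u n j * u n m).
  by apply/funext => n; rewrite big_nat_recr.
exact: ccvgM.
Qed.

Variables (y : nat -> nat -> R) (K : R).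
Hypothesis y_ge0 : forall n j, 0 <= y n j.
Hypothesis y_incr : forall n j, y n j <= y n.+1 j.
Hypothesis y_sum : forall n m, \sum_(0 <= j < m) y n j <= K.

Definition lim_y j := sup [set y n j | n in [set: nat]].

Let y_has_sup j : has_sup [set y n j | n in [set: nat]].
Proof.
split; first by exists (y 0%N j), 0%N.
exists K => _ [n _ <-]; apply: le_trans (y_sum n j.+1).
by rewrite big_nat_recr //= lerDr sumr_nat_ge0.
Qed.

Lemma le_lim_y n j : y n j <= lim_y j.
Proof. by apply: ub_le_sup; [case: (y_has_sup j)|exists n]. Qed.

Lemma lim_y_ge0 j : 0 <= lim_y j.
Proof. exact: le_trans (le_lim_y 0 j). Qed.

Lemma y_le n m j : (n <= m)%N -> y n j <= y m j.
Proof.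
move/subnKC <-; elim: (m - n)%N => [|k IH]; first by rewrite addn0.
by apply: le_trans IH _; rewrite addnS.
Qed.

Lemma lim_y_cvg j e : 0 < e ->
  exists N, forall n, (N <= n)%N -> lim_y j - e < y n j.
Proof.
move=> e0; have [_ [N _ <-] hN] := sup_adherent e0 (y_has_sup j).
by exists N => n /(y_le j); apply: lt_le_trans.
Qed.

Lemma lim_y_sum m : \sum_(0 <= j < m) lim_y j <= K.
Proof.
apply/ler_addgt0Pr => e e0.
suff [n hn] : exists n, \sum_(0 <= j < m) lim_y j <= \sum_(0 <= j < m) y n j + e.
  by apply: le_trans hn _; rewrite lerD2r.
elim: m e e0 => [|m IH] e e0.
  by exists 0%N; rewrite !big_geq // add0r ltW.
have e2 : 0 < e / 2 by lra.
have [n hn] := IH _ e2; have [N hN] := lim_y_cvg m e2.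
exists (maxn n N); rewrite !big_nat_recr //=.
have := hN _ (leq_maxr n N).
have : \sum_(0 <= j < m) y n j <= \sum_(0 <= j < m) y (maxn n N) j.
  by apply: ler_sum => j _; apply: y_le; exact: leq_maxl.
by move: hn; lra.
Qed.

Lemma lim_y_le i j : (forall n, y n i <= y n j) -> lim_y i <= lim_y j.
Proof.
move=> h; apply: sup_le_ub; first by case: (y_has_sup i).
by move=> _ [n _ <-]; apply: le_trans (h n) (le_lim_y n j).
Qed.

Variables (z D : R[i]).
Hypothesis D_lim : ccvg (fun n => \prod_(0 <= j < n) (1 - z * (y n j)%:C)) D.

Let c := cmod z.

Lemma cmod_prod_lim_y m n (t : nat -> R) : (forall j, 0 <= t j) ->
  cmod (\prod_(m <= j < n) (1 - z * (t j)%:C)) <= expR (c * \sum_(m <= j < n) t j).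
Proof.
move=> t0; apply: le_trans (cmod_prod_le (fun j => - (z * (t j)%:C)) m n) _.
rewrite ler_expR mulr_sumr; apply: ler_sum => j _.
by rewrite cmodN cmodM cmod_real ger0_norm.
Qed.

Lemma cmod_prod_lim_y_sub1 m n (t : nat -> R) : (forall j, 0 <= t j) ->
  cmod (\prod_(m <= j < n) (1 - z * (t j)%:C) - 1) <= expR (c * \sum_(m <= j < n) t j) - 1.
Proof.
move=> t0; apply: le_trans (cmod_prod_sub1 (fun j => - (z * (t j)%:C)) m n) _.
rewrite lerD2r ler_expR mulr_sumr; apply: ler_sum => j _.
by rewrite cmodN cmodM cmod_real ger0_norm.
Qed.

Let c_ge0 : 0 <= c. Proof. exact: cmod_ge0. Qed.

Let tail_exp e : 0 < e -> exists m0, forall m n, (m0 <= m)%N ->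
  expR (c * \sum_(m <= j < n) lim_y j) - 1 <= e.
Proof.
move=> e0; have [d d0 hd] := expR_sub1_small e0.
have d1 : 0 < d / (c + 1) by rewrite divr_gt0 //; have := c_ge0; lra.
have [m0 hm0] := tail_small lim_y_ge0 lim_y_sum d1.
exists m0 => m n m0m; apply: hd.
have h : \sum_(m <= j < n) lim_y j <= d / (c + 1).
  apply: le_trans (ltW (hm0 n)).
  have [mn|nm] := leqP m n.
    by rewrite (big_cat_nat m0m mn) /= lerDr sumr_nat_ge0 // => j; exact: lim_y_ge0.
  by rewrite big_geq ?(ltnW nm) // sumr_nat_ge0 // => j; exact: lim_y_ge0.
apply: le_trans (ler_wpM2l c_ge0 h) _.
rewrite mulrA ler_pdivrMr; last by have := c_ge0; lra.
by rewrite mulrC ler_wpM2l ?(ltW d0) // lerDl.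
Qed.

(** Tannery's argument for products: since [y n j] is at most [lim_y j], cutting the n-th product at
    m costs at most exp (c K) (exp (c tail) - 1), with the tail of [lim_y], uniformly in n; with m
    fixed, n then tends to infinity. *)
Lemma infinite_product_cvg :
  ccvg (fun m => \prod_(0 <= j < m) (1 - z * (lim_y j)%:C)) D.
Proof.
move=> e e0.
have K0 : 0 <= K by have := y_sum 0 0; rewrite big_geq.
have e1 : 0 < e / (2 * expR (c * K)) by rewrite divr_gt0 // mulr_gt0 // expR_gt0.
have [m0 hm0] := tail_exp e1; exists m0 => m m0m; rewrite cmodC.
apply: (@le_lt_trans _ _ (e / 2)); last by lra.
pose u n := \prod_(0 <= j < n) (1 - z * (y n j)%:C) - \prod_(0 <= j < m) (1 - z * (y n j)%:C).
have hu : ccvg u (D - \prod_(0 <= j < m) (1 - z * (lim_y j)%:C)).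
  rewrite /u; have h : ccvg (fun n => \prod_(0 <= j < m) (1 - z * (y n j)%:C))
      (\prod_(0 <= j < m) (1 - z * (lim_y j)%:C)).
    apply: (@ccvg_prod (fun n j => 1 - z * (y n j)%:C)) => j.
    have hy : ccvg (fun n => (y n j)%:C : R[i]) (lim_y j)%:C.
      move=> e' /(lim_y_cvg j)[N hN]; exists N => n /hN hn.
      rewrite -rmorphB cmod_real ler0_norm ?subr_le0 ?le_lim_y // opprB; lra.
    have := ccvg_lin (- z) hy (ccvg_cst 1).
    by congr ccvg; [apply/funext => n|]; ring.
  have := ccvg_lin (-1) h D_lim.
  by congr ccvg; [apply/funext => n|]; ring.
rewrite -[D - _]subr0; apply: (ccvg_le hu); exists m => n mn; rewrite subr0 /u.
rewrite (big_cat_nat (leq0n m) mn) /= -[X in _ - X]mulr1 -mulrBr cmodM.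
have -> : e / 2 = expR (c * K) * (e / (2 * expR (c * K))).
  by field; rewrite gt_eqF ?expR_gt0.
apply: ler_pM; rewrite ?cmod_ge0 //.
  apply: le_trans (cmod_prod_lim_y _ _ (y_ge0 n)) _.
  by rewrite ler_expR ler_wpM2l.
apply: le_trans (cmod_prod_lim_y_sub1 _ _ (y_ge0 n)) _.
apply: le_trans (hm0 m n m0m); rewrite lerD2r ler_expR ler_wpM2l //.
by apply: ler_sum => j _; exact: le_lim_y.
Qed.

(** A late tail of the product stays within 1/2 of 1, so the limit can vanish only through one of
    the finitely many earlier factors. *)
Lemma infinite_product_zeros : D = 0 <-> exists j, z * (lim_y j)%:C = 1.
Proof.
have Dcvg := infinite_product_cvg; split=> [D0|[j zj]]; last first.
  apply: ccvg_unique Dcvg _ => e e0; exists j.+1 => n jn.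
  rewrite (bigD1_seq j) ?iota_uniq //= ?mem_index_iota ?jn //.
  by rewrite zj subrr mul0r subrr cmod0.
apply: contrapT => nz.
have nz' j : 1 - z * (lim_y j)%:C != 0.
  by rewrite subr_eq0 eq_sym; apply/eqP => h; apply: nz; exists j.
have half : 0 < 1 / 2 :> R by lra.
have [m hm] := tail_exp half.
pose q := cmod (\prod_(0 <= j < m) (1 - z * (lim_y j)%:C)).
have q0 : 0 < q by rewrite cmod_gt0 prodf_seq_neq0; apply/allP => j _ /=.
have q2 : 0 < q / 2 by lra.
have [N hN] := Dcvg _ q2; have := hN _ (leq_maxr m N).
rewrite D0 subr0 (big_cat_nat (leq0n m) (leq_maxl m N)) /= cmodM -/q.
set x := \prod_(_ <= _ < _) _ => h.
have := le_trans (cmod_prod_lim_y_sub1 m (maxn m N) lim_y_ge0) (hm m (maxn m N) (leqnn _)).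
rewrite -/x => h1.
have h2 : 1 - cmod x <= cmod (x - 1).
  by have := cmodB x (x - 1); rewrite opprB addrC subrK cmod1; lra.
have : q * (1 / 2) <= q * cmod x by rewrite ler_wpM2l ?(ltW q0) //; lra.
by lra.
Qed.

Lemma double_zero_bound i j : i != j ->
  cmod D <= cmod (1 - z * (lim_y i)%:C) * cmod (1 - z * (lim_y j)%:C) * expR (c * K).
Proof.
move=> ij; rewrite -[D]subr0; apply: (ccvg_le infinite_product_cvg).
exists (maxn i j).+1 => m; rewrite gtn_max => /andP[im jm]; rewrite subr0.
rewrite (bigD1_seq i) ?iota_uniq //= ?mem_index_iota ?im //.
rewrite big_mkcond /= (bigD1_seq j) ?iota_uniq //= ?mem_index_iota ?jm //.
rewrite eq_sym ij !cmodM -mulrA ler_wpM2l ?cmod_ge0 // ler_wpM2l ?cmod_ge0 //.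
(* Setting the two extracted entries to 0 turns their factors into 1, so the bound for full products
   applies to what is left. *)
pose t k := if (k != j) && (k != i) then lim_y k else 0.
have t0 k : 0 <= t k by rewrite /t; case: ifP => // _; exact: lim_y_ge0.
rewrite big_mkcond /= (eq_bigr (fun k => 1 - z * (t k)%:C)); last first.
  move=> k _; rewrite /t; case: (k != j) => //=; last by rewrite mulr0 subr0.
  by case: (k != i) => //; rewrite mulr0 subr0.
apply: le_trans (cmod_prod_lim_y 0 m t0) _; rewrite ler_expR ler_wpM2l //.
apply: le_trans (lim_y_sum m); apply: ler_sum => k _; rewrite /t.
by case: ifP => // _; exact: lim_y_ge0.
Qed.

End Products.

(** * Simplicity of the zeros *)

Section ContinuityAt.
Context {R : realType}.
Implicit Types (f g : R[i] -> R[i]) (z : R[i]).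

Definition ccont f z0 := forall e : R, 0 < e ->
  exists2 d : R, 0 < d & forall z, cmod (z - z0) < d -> cmod (f z - f z0) < e.

Lemma ccont_horner (p : {poly R[i]}) z0 : ccont (fun z => p.[z]) z0.
Proof.
elim/poly_ind: p => [|p c IH] e e0.
  by exists 1 => // z _; rewrite !horner0 subrr cmod0.
have q0 : 0 < 1 + cmod z0 by have := cmod_ge0 z0; lra.
have r0 : 0 < 1 + cmod p.[z0] by have := cmod_ge0 p.[z0]; lra.
have [d d0 hd] := IH (e / 2 / (1 + cmod z0)) (divr_gt0 (divr_gt0 e0 (ltr0Sn R 1)) q0).
pose d' := e / 2 / (1 + cmod p.[z0]).
have d'0 : 0 < d' by rewrite !divr_gt0.
exists (Num.min 1 (Num.min d d')); first by rewrite !lt_min ltr01 d0.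
move=> z; rewrite !lt_min => /and3P[h1 /hd h2 h3].
rewrite !hornerE.
have -> : p.[z] * z + c - (p.[z0] * z0 + c) =
  (p.[z] - p.[z0]) * z + p.[z0] * (z - z0) by ring.
apply: le_lt_trans (cmodD _ _) _; rewrite !cmodM [e]splitr.
have zle : cmod z <= 1 + cmod z0.
  by have := cmodD (z - z0) z0; rewrite subrK; lra.
apply: ler_ltD.
  apply: (@le_trans _ _ (e / 2 / (1 + cmod z0) * (1 + cmod z0))).
    by apply: ler_pM; rewrite ?cmod_ge0 // ltW.
  by rewrite divfK // gt_eqF.
apply: (@le_lt_trans _ _ ((1 + cmod p.[z0]) * cmod (z - z0))).
  by rewrite ler_wpM2r ?cmod_ge0 // lerDr.
by rewrite mulrC -ltr_pdivlMr.
Qed.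

End ContinuityAt.

Section ZerosOfCharD.
Context {R : realType}.
Variables a b : nat -> R.
Hypothesis a_gt0 : forall n, 0 < a n.
Variable T : (nat -> R[i]) -> nat -> R[i].
Local Notation jact := (jacobi_action a b).
Local Notation J := (jacobi_op a b).
Local Notation P := (P0 a b).
Local Notation w := (W0 T).
Hypothesis T_inv : bounded_inverse J T.
Hypothesis J_pos : positive_definite J.
Variable tau : R.
Hypothesis trace_le : forall n, \sum_(0 <= k < n) P k * w k <= tau.
Implicit Types (z : R[i]).

Local Notation pz := (first_kind a b).
Local Notation qz := (second_kind a b).
Local Notation D := (charD a b T).
Local Notation E := (weylE a b T).

Let PW := P0W0_gt0 a_gt0 T_inv J_pos.
Let PP := P0_alternate a_gt0 J_pos.

Let P_neq0 n : P n != 0.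
Proof. by apply/eqP => h; have := PW n; rewrite h mul0r ltxx. Qed.

Let tau_ge0 : 0 <= tau.
Proof. by have := trace_le 0; rewrite big_geq. Qed.

Let w0_ge0 : 0 <= w 0.
Proof. by have := PW 0; rewrite P0_0 mul1r => /ltW. Qed.

Definition second_kind_bound (r : R) := w 0 * expR (r * tau).

Lemma second_kind_term_le r z k : cmod z <= r ->
  cmod ((w k)%:C * qz z k) <= second_kind_bound r * (P k * w k).
Proof.
move=> zr; rewrite cmodM cmod_real.
have := jacobi_solution_growth a_gt0 T_inv J_pos trace_le k (second_kind_solution b a_gt0 z).
rewrite {2}/second_kind /= horner0 cmod0 cmod1 add0r mul1r => h.
apply: le_trans (ler_wpM2l (normr_ge0 _) h) _.
have -> : P k * w k = `|w k| * `|P k| by rewrite -normrM [w k * _]mulrC ger0_norm // (ltW (PW k)).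
rewrite mulrCA ler_wpM2r ?mulr_ge0 // /second_kind_bound ler_wpM2l // ler_expR.
by rewrite ler_wpM2r.
Qed.

(** The majorant, a multiple of [P k * w k], does not depend on z in the disc. This gives both the
    continuity of [weylE] and the locally uniform convergence of the series. *)
Lemma second_kind_tail r e : 0 < e -> exists m, forall z n, cmod z <= r -> (m <= n)%N ->
  cmod (csum (fun k => (w k)%:C * qz z k) - \sum_(0 <= k < n) (w k)%:C * qz z k) <= e.
Proof.
move=> e0; have B0 : 0 <= second_kind_bound r by rewrite mulr_ge0 ?expR_ge0.
have B1 : 0 < second_kind_bound r + 1 by lra.
have PW0 k : 0 <= P k * w k by exact: (ltW (PW k)).
have [m hm] := tail_small PW0 trace_le (divr_gt0 e0 B1).
exists m => z n zr mn; apply: csum_dist.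
  exact: (jacobi_solution_abssum a_gt0 T_inv J_pos trace_le (second_kind_solution b a_gt0 z)).
move=> N; apply: (@le_trans _ _ (\sum_(n <= k < N) second_kind_bound r * (P k * w k))).
  by apply: ler_sum => k _; exact: second_kind_term_le.
rewrite -mulr_sumr.
have h : \sum_(n <= k < N) P k * w k <= e / (second_kind_bound r + 1).
  apply: le_trans (ltW (hm N)); have [nN|Nn] := leqP n N.
    by rewrite (big_cat_nat mn nN) /= lerDr sumr_nat_ge0.
  by rewrite big_geq ?(ltnW Nn) // sumr_nat_ge0.
apply: le_trans (ler_wpM2l B0 h) _.
by rewrite mulrA ler_pdivrMr // mulrC ler_wpM2l ?(ltW e0) // lerDl.
Qed.

Lemma weylE_continuous z0 : ccont E z0.
Proof.
have EE z : E z = (w 0)%:C + z * csum (fun k => (w k)%:C * qz z k).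
  by rewrite /weylE /solution_limit /second_kind /= horner0; ring.
pose S z := csum (fun k => (w k)%:C * qz z k).
move=> e e0; pose r := cmod z0 + 1.
have r0 : 0 < r by rewrite /r; have := cmod_ge0 z0; lra.
have e1 : 0 < e / 4 / r by rewrite !divr_gt0.
have [m hm] := second_kind_tail r e1.
pose p : {poly R[i]} := 'X * \sum_(0 <= k < m) (w k)%:C *: second_kind_poly a b k.
have pE z : p.[z] = z * \sum_(0 <= k < m) (w k)%:C * qz z k.
  rewrite /p hornerM hornerX horner_sum; congr (_ * _).
  by apply: eq_bigr => k _; rewrite hornerZ.
have e2 : 0 < e / 2 by lra.
have [d d0 hd] := ccont_horner p z0 e2.
exists (Num.min 1 d); first by rewrite lt_min ltr01.
move=> z; rewrite lt_min => /andP[h1 /hd h2].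
have zr : cmod z <= r by have := cmodD (z - z0) z0; rewrite subrK /r; lra.
have z0r : cmod z0 <= r by rewrite /r; lra.
have tailz z' : cmod z' <= r -> cmod (z' * S z' - p.[z']) <= e / 4.
  move=> z'r; rewrite pE -mulrBr cmodM.
  have -> : e / 4 = r * (e / 4 / r) by rewrite [RHS]mulrC divfK // gt_eqF.
  by apply: ler_pM; rewrite ?cmod_ge0 // hm.
rewrite !EE -/(S z) -/(S z0).
have -> : (w 0)%:C + z * S z - ((w 0)%:C + z0 * S z0) =
  (z * S z - p.[z]) + ((p.[z] - p.[z0]) - (z0 * S z0 - p.[z0])) by ring.
apply: le_lt_trans (cmodD _ _) _.
have := tailz _ zr; have := tailz _ z0r; have := cmodB (p.[z] - p.[z0]) (z0 * S z0 - p.[z0]).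
lra.
Qed.

Lemma second_kind_poly_action z u0 u1 n :
  jact (fun k => u0 * qz z k - u1 * pz z k) n =
  z * (u0 * qz z n - u1 * pz z n) + u0 * l2_basis 0 n.
Proof.
have -> : (fun k => u0 * qz z k - u1 * pz z k) =
   (fun k => u0 * qz z k + (- u1 * pz z k + 0)) by apply/funext => k; ring.
rewrite !jacobi_action_lin first_kind_action // /second_kind second_kind_action //.
have -> : jact (fun=> 0) n = 0.
  by case: n => [|n]; rewrite ?jacobi_action0 ?jacobi_actionS !mulr0 !addr0.
ring.
Qed.

(* Green's formula for u k = p n * q k - q n * p k, which vanishes at k = n. *)
Lemma herglotz_finite z n : cmod (qz z n) * `|complex.Im z| <= cmod (pz z n).
Proof.
pose u k := pz z n * qz z k - qz z n * pz z k.
pose v k := conjc (u k).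
have un : u n = 0 by rewrite /u; ring.
have u0 : u 0%N = - qz z n.
  by rewrite /u first_kind0 {1}/second_kind /= horner0; ring.
have ju k : jact u k = z * u k + pz z n * l2_basis 0 k by exact: second_kind_poly_action.
have := green_finite a b v u n; rewrite /v un conjc0 mul0r mulr0 subrr mulr0.
rewrite (eq_bigr (fun k => (conjc z - z) * (cmod (u k) ^+ 2)%:C +
   (conjc (pz z n) * u 0%N - conjc (conjc (pz z n) * u 0%N)) * l2_basis 0 k)); last first.
  have key U K (d : bool) : conjc (z * U + K * d%:R) * U - conjc U * (z * U + K * d%:R) =
     (conjc z - z) * (conjc U * U) + (conjc K * U - conjc (conjc K * U)) * d%:R.
    by rewrite rmorphD !rmorphM /= conjc_nat conjcK; ring.
  move=> k _; rewrite jacobi_actionJ ju cmod_sqr {}key.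
  by case: k => [//|k]; rewrite /l2_basis /= !mulr0.
have sum_basis : \sum_(0 <= k < n.+1) l2_basis 0 k = 1 :> R[i].
  by rewrite big_nat_recl //= big1 ?addr0.
rewrite big_split /= -!mulr_sumr {}sum_basis mulr1 -rmorph_sum /=.
set S := \sum_(_ <= _ < _) _; set x := conjc _ * u 0%N => h.
(* The imaginary part of Green's formula is Im z times [S] = Im [x]. The term k = 0 of [S] is
   already |q_n|^2, and |x| = |p_n| |q_n|, so one factor |q_n| cancels. *)
have Sge : cmod (u 0%N) ^+ 2 <= S.
  rewrite /S big_nat_recl //= lerDl.
  by apply: sumr_ge0 => k _; exact: sqr_ge0.
have imx : complex.Im z * S = complex.Im x.
  move: h; case: (z) => p q; case: (x) => p' q' /= [_].
  by rewrite mulr0 add0r; lra.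
have hx : `|complex.Im z| * cmod (u 0%N) ^+ 2 <= cmod (pz z n) * cmod (u 0%N).
  apply: (@le_trans _ _ (`|complex.Im z| * S)); first by rewrite ler_wpM2l.
  have S0 : 0 <= S by apply: le_trans Sge; exact: sqr_ge0.
  rewrite -[S](ger0_norm S0) -normrM imx; apply: le_trans (cmod_ge_Im _) _.
  by rewrite /x cmodM cmodJ.
move: hx; rewrite u0 cmodN => hx.
have := cmod_ge0 (qz z n); rewrite le_eqVlt => /predU1P[<-|q0].
  by rewrite mul0r cmod_ge0.
by rewrite -(ler_pM2r q0) mulrAC -expr2 mulrC.
Qed.

(** The limit of [herglotz_finite] divided by [|P n|]. *)
Lemma herglotz z : cmod (E z) * `|complex.Im z| <= cmod (D z).
Proof.
have hq := jacobi_solution_cvg a_gt0 T_inv J_pos trace_le (second_kind_solution b a_gt0 z).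
have hp := jacobi_solution_cvg a_gt0 T_inv J_pos trace_le (first_kind_solution b a_gt0 z).
rewrite -/(D z) in hp; rewrite -[cmod (E z)]cmodN /weylE opprK.
set L := solution_limit _ _ _ _ in hq *; set I := `|_|.
have I0 : 0 <= I by exact: normr_ge0.
apply/ler_addgt0Pr => e e0; have I1 : 0 < 1 + I by lra.
have d0 : 0 < e / (1 + I) by rewrite divr_gt0.
have [N1 h1] := hq _ d0; have [N2 h2] := hp _ d0.
set n := maxn N1 N2.
have := h1 n (leq_maxl _ _); have := h2 n (leq_maxr _ _).
set x := pz z n / _; set y := qz z n / _ => hx hy.
have xy : cmod y * I <= cmod x.
  rewrite /x /y !cmodM mulrAC ler_wpM2r ?cmod_ge0 //.
  exact: herglotz_finite.
have hL : cmod L <= cmod y + e / (1 + I).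
  by have := cmodB y (y - L); rewrite opprB addrC subrK; lra.
have hx' : cmod x <= cmod (D z) + e / (1 + I).
  by have := cmodD (x - D z) (D z); rewrite subrK; lra.
apply: le_trans (ler_wpM2r I0 hL) _.
have : e / (1 + I) * (1 + I) = e by rewrite divfK // gt_eqF.
by move: xy hx'; set k := e / _; lra.
Qed.

Lemma charD_weylE_no_common_zero z : D z = 0 -> E z = 0 -> False.
Proof.
move=> Dz Ez.
have [C C0 hC] := jacobi_solution_decay a_gt0 T_inv J_pos trace_le (first_kind_solution b a_gt0 z) Dz.
have Lq : solution_limit w z 1 (qz z) = 0 by apply/eqP; rewrite -oppr_eq0; apply/eqP.
have [C' C'0 hC'] := jacobi_solution_decay a_gt0 T_inv J_pos trace_le (second_kind_solution b a_gt0 z) Lq.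
have lp := l2_decay a_gt0 T_inv J_pos hC; have lq := l2_decay a_gt0 T_inv J_pos hC'.
have lv : l2 (fun n => z * qz z n + l2_basis 0 n).
  by apply: l2_lin => //; exact: l2_basis_l2.
have [] := jacobi_op_max a_gt0 T_inv lq lv.
  by move=> n; rewrite /second_kind second_kind_action.
move=> Jq _.
have jp : jact (pz z) = (fun n => z * pz z n).
  by apply/funext => n; rewrite first_kind_action.
have ljp : l2 (jact (pz z)) by rewrite jp; exact: l2Z.
(* The two sides differ by the pairing of the source e_0 of the second kind with the first kind,
   which is p_0 = 1. *)
have := green Jq lp ljp; rewrite jp.
have aqp : abssum (fun k => qz z k * pz z k) by exact: l2_abssum.
have -> : csum (fun k => qz z k * (z * pz z k)) = z * csum (fun k => qz z k * pz z k).
  by rewrite -csumZ //; apply: eq_csum => k; ring.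
rewrite (eq_csum (v := fun k => z * (qz z k * pz z k) + pz z k * l2_basis 0 k)); last first.
  by move=> k; ring.
rewrite csum_lin //; last by apply: l2_abssum => //; exact: l2_basis_l2.
rewrite csum_basis first_kind0 -[RHS]addr0 => /addrI/eqP.
by rewrite oner_eq0.
Qed.

Lemma charD_product : exists lam : nat -> R,
  [/\ forall j, 0 < lam j, forall j, lam j.+1 < lam j,
      forall z, ccvg (fun m => \prod_(0 <= j < m) (1 - z * (lam j)%:C)) (D z)
    & forall z, D z = 0 <-> exists j, z * (lam j)%:C = 1].
Proof.
have [y [y_ge0 y_gt0 y_incr y_decr yE]] := first_kind_factorization a_gt0 PP.
have pE n z : pz z n / (P n)%:C = \prod_(0 <= j < n) (1 - z * (y n j)%:C).
  by rewrite yE mulrC mulKf // -[0]/(0%:C) (inj_eq (@complexI R)).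
(* At z = -1 every factor is 1 + y, so the sum is at most p_N(-1) / p_N(0), which the growth
   estimate bounds by exp tau. *)
have y_sum n m : \sum_(0 <= j < m) y n j <= expR tau.
  pose N := maxn n m.
  apply: (@le_trans _ _ (\sum_(0 <= j < N) y N j)).
    apply: (@le_trans _ _ (\sum_(0 <= j < m) y N j)).
      apply: ler_sum => j _; apply: y_le; [exact: y_incr|exact: leq_maxl].
    by apply: ler_sum_widen; rewrite ?leq_maxr.
  apply: (@le_trans _ _ (\prod_(0 <= j < N) (1 + y N j))).
    suff sumprod k : \sum_(0 <= j < k) y N j + 1 <= \prod_(0 <= j < k) (1 + y N j).
      by have := sumprod N; lra.
    elim: k => [|k IH]; first by rewrite !big_geq //; lra.
    rewrite !big_nat_recr //=.
    have h : 1 <= \prod_(0 <= i < k) (1 + y N i).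
      have h0 : 0 <= \sum_(0 <= j < k) y N j by exact: sumr_nat_ge0.
      by move: IH h0; lra.
    have := ler_wpM2r (y_ge0 N k) h; move: IH; lra.
  have -> : \prod_(0 <= j < N) (1 + y N j) = cmod (pz (-1) N / (P N)%:C).
    rewrite pE; have -> : \prod_(0 <= j < N) (1 - -1 * (y N j)%:C) =
        (\prod_(0 <= j < N) (1 + y N j))%:C.
      by rewrite rmorph_prod /=; apply: eq_bigr => j _; rewrite rmorphD rmorph1 /=; ring.
    by rewrite cmod_real ger0_norm //; apply: prodr_ge0 => j _; rewrite addr_ge0.
  have := jacobi_solution_growth a_gt0 T_inv J_pos trace_le N (first_kind_solution b a_gt0 (-1)).
  rewrite cmodM cmodV cmod_real first_kind0 cmod0 mul0r addr0 cmodN cmod1 !mul1r.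
  by rewrite ler_pdivrMr // normr_gt0.
have Dlim z : ccvg (fun n => \prod_(0 <= j < n) (1 - z * (y n j)%:C)) (D z).
  have := jacobi_solution_cvg a_gt0 T_inv J_pos trace_le (first_kind_solution b a_gt0 z).
  by congr ccvg; apply/funext => n; rewrite pE.
pose lam := lim_y y.
have zeros z : D z = 0 <-> exists j, z * (lam j)%:C = 1.
  exact: (infinite_product_zeros y_ge0 y_incr y_sum (Dlim z)).
have lam_gt0 j : 0 < lam j.
  by apply: lt_le_trans (y_gt0 j.+1 j (ltnSn j)) _; exact: le_lim_y y_sum _ _.
exists lam; split=> // [j|z]; last exact: (infinite_product_cvg y_ge0 y_incr y_sum (Dlim z)).
have lam_le : lam j.+1 <= lam j by apply: (lim_y_le y_ge0 y_sum) => n; exact: y_decr.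
rewrite lt_neqAle lam_le andbT; apply/eqP => lamE.
set t := lam j in lamE; have t0 : 0 < t by exact: lam_gt0.
pose x : R[i] := (t^-1)%:C.
have xt : x * t%:C = 1 by rewrite /x -rmorphM /= mulVf ?gt_eqF.
apply: (@charD_weylE_no_common_zero x); first by apply/zeros; exists j.
apply: cmod_le0; apply/ler_addgt0Pr => e e0; rewrite add0r.
have e2 : 0 < e / 2 by lra.
have [d d0 hd] := weylE_continuous x e2.
(* At distance [ep] above the double zero 1/t, two factors have modulus [ep * t] and the others
   contribute the exponential, as |z| <= 1/t + 1; so |D| <= ep^2 M, and [herglotz] leaves |E| <= ep
   M. The three bounds on [ep] serve |z|, this estimate and the continuity of E. *)
pose M := t ^+ 2 * expR ((t^-1 + 1) * expR tau).
have M0 : 0 < M by rewrite mulr_gt0 ?expR_gt0 ?exprn_gt0.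
pose ep := Num.min 1 (Num.min (d / 2) (e / 2 / M)).
have ep0 : 0 < ep by rewrite !lt_min ltr01 !divr_gt0.
have ep1 : ep <= 1 by rewrite ge_min lexx.
have epd : ep < d.
  by apply: (@le_lt_trans _ _ (d / 2)); [rewrite !ge_min lexx orbT|lra].
have epM : ep * M <= e / 2.
  by rewrite -ler_pdivlMr // !ge_min lexx !orbT.
pose z : R[i] := t^-1 +i* ep.
have zx : cmod (z - x) = ep.
  by rewrite cmodE /= subrr subr0 expr0n add0r sqrtr_sqr gtr0_norm.
have z1 : cmod (1 - z * t%:C) = ep * t.
  have -> : 1 - z * t%:C = - ((z - x) * t%:C) by rewrite mulrBl xt; ring.
  by rewrite cmodN cmodM zx cmod_real gtr0_norm.
have zle : cmod z <= t^-1 + 1.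
  have := cmodD (z - x) x; rewrite subrK zx /x cmod_real gtr0_norm ?invr_gt0 //; lra.
have := herglotz z; rewrite /= gtr0_norm // => h.
have := double_zero_bound y_ge0 y_incr y_sum (Dlim z) (_ : j != j.+1).
rewrite -/lam lamE -/t z1 neq_ltn ltnSn => /(_ isT) h2.
have h3 : expR (cmod z * expR tau) <= expR ((t^-1 + 1) * expR tau).
  by rewrite ler_expR ler_wpM2r ?expR_ge0.
have h4 : cmod (D z) <= ep * t * (ep * t) * expR ((t^-1 + 1) * expR tau).
  by apply: le_trans h2 _; rewrite ler_wpM2l // !mulr_ge0 // ltW.
have h5 : cmod (E z) <= ep * M.
  rewrite -(ler_pM2r ep0); apply: le_trans h _; apply: le_trans h4 _.
  by rewrite le_eqVlt; apply/orP; left; apply/eqP; rewrite /M; ring.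
have := hd z; rewrite zx => /(_ epd).
by have := cmodB (E z) (E z - E x); rewrite opprB addrC subrK; lra.
Qed.

End ZerosOfCharD.

(** * The theorem *)

(** If the sequences agree before n, the value f n is some g k, and k < n is impossible since then g
    k = f k < f n; so g n <= f n, and symmetrically. *)
Lemma increasing_same_range (R : realType) (f g : nat -> R) :
  {homo f : m n / (m < n)%N >-> m < n} -> {homo g : m n / (m < n)%N >-> m < n} ->
  (forall n, exists m, f n = g m) -> (forall n, exists m, g n = f m) -> f =1 g.
Proof.
move=> fh gh fg gf n; have [m] := ubnP n; elim: m n => // m IH n; rewrite ltnS => nm.
have le_of (p q : nat -> R) : {homo p : m n / (m < n)%N >-> m < n} ->
    {homo q : m n / (m < n)%N >-> m < n} -> (forall k, (k < n)%N -> p k = q k) ->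
    (exists k, p n = q k) -> q n <= p n.
  move=> ph qh pq [k pk]; have [nk|kn] := leqP n k.
    by rewrite pk; move: nk; rewrite leq_eqVlt => /predU1P[->//|/qh/ltW].
  by have := ph _ _ kn; rewrite pk pq // ltxx.
apply/eqP; rewrite eq_le; apply/andP; split.
  by apply: le_of => // k kn; rewrite IH // (leq_trans kn).
by apply: le_of => // k kn; rewrite IH // (leq_trans kn).
Qed.

Lemma locally_uniform_cvg_ball (R : realType) (f : nat -> R[i] -> R[i]) (g : R[i] -> R[i]) :
  (forall z0 (e : R), 0 < e -> exists N, forall n z, (N <= n)%N ->
     cmod (z - z0) < 1 -> cmod (f n z - g z) < e) ->
  locally_uniform_cvg f g.
Proof.
move=> h z0; exists [set z | cmod (z - z0) < 1].
  apply/nbhs_ballP; exists 1 => /=; first exact: ltr01.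
  move=> z; rewrite -ball_normE /= distrC normc_cmod => hz.
  by rewrite -ltcR.
move=> A /uniform_nbhs[E [entE EA]].
have [e e0 eE] : exists2 e : R, 0 < e & forall x y : R[i], cmod (y - x) < e -> E (x, y).
  move: entE; rewrite -entourage_ballE => -[[e e'] /=].
  rewrite ltcE /= => /andP[/eqP -> e0] he; exists e => // x y xy.
  by apply: he; rewrite /= -ball_normE /= distrC normc_cmod ltcR.
have [N hN] := h z0 e e0; exists N => // n /= Nn; apply: EA => z hz.
exact/eE/hN.
Qed.

Unset Implicit Arguments.

Theorem theorem2p6 (R : realType) (a b zeta : nat -> R)
    (a_gt0 : forall n, 0 < a n)
    (J_pos : positive_definite (jacobi_op a b))
    (J_inv : exists2 T, bounded_inverse (jacobi_op a b) T & l2_trace_class T)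
    (J_spec : spectrum_enumeration a b zeta) :
  (forall z : R[i], regularized_weyl_fun a b zeta z =
     second_kind_fun a b 0 0 + z * limn (second_kind_series a b z)) /\
  locally_uniform_cvg (fun N z => second_kind_series a b z N)
                      (fun z => limn (second_kind_series a b z)).
Proof.
have [T T_inv T_tr] := J_inv.
have [tau trace_le] := trace_bound a_gt0 T_inv J_pos T_tr.
split; last first.
  apply: locally_uniform_cvg_ball => z0 e e0.
  have e2 : 0 < e / 2 by lra.
  have [m hm] := second_kind_tail a_gt0 T_inv J_pos trace_le (cmod z0 + 1) e2.
  exists m => n z mn hz; rewrite cmodC (second_kind_seriesE a_gt0 T_inv J_pos).
  apply: (@le_lt_trans _ _ (e / 2)); last by lra.
  apply: hm => //; have := cmodD (z - z0) z0; rewrite subrK; lra.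
have [lam [lam_gt0 lam_lt D_cvg D_zero]] := charD_product a_gt0 T_inv J_pos trace_le.
have [zeta_homo specE] := J_spec.
have lam_homo : {homo (fun n => (lam n)^-1) : m n / (m < n)%N >-> m < n}.
  move=> m n mn; rewrite ltf_pV2 ?posrE //.
  elim: n mn => // n IH; rewrite ltnS leq_eqVlt => /predU1P[->//|/IH].
  exact: lt_trans.
have lamC j : (lam j)%:C != 0 :> R[i].
  by rewrite -[0]/(0%:C) (inj_eq (@complexI R)) gt_eqF.
have spec_lam (z : R[i]) : spectrum (jacobi_op a b) z <-> exists j, z = ((lam j)^-1)%:C.
  rewrite (spectrumP a_gt0 T_inv J_pos trace_le) D_zero; split=> -[j hj]; exists j.
    by rewrite fmorphV /= -[LHS](mulfK (lamC j)) hj mul1r.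
  by rewrite hj fmorphV /= mulVf.
(* Simplicity of the zeros enters here: without the strict decrease of [lam] only the ranges could
   be compared. *)
have zetaE n : zeta n = (lam n)^-1.
  apply: (increasing_same_range zeta_homo lam_homo) => k.
    have /spec_lam[j] : spectrum (jacobi_op a b) (zeta k)%:C by rewrite specE; exists k.
    by move=> /complexI ->; exists j.
  have : spectrum (jacobi_op a b) ((lam k)^-1)%:C by apply/spec_lam; exists k.
  by rewrite specE => -[j _ /complexI <-]; exists j.
have charE z : characteristic_fun zeta z = charD a b T z.
  apply: ccvg_lim; have := D_cvg z; congr ccvg; apply/funext => N.
  by apply: eq_bigr => j _; rewrite zetaE fmorphV invrK.
have E_res z : resolvent_set (jacobi_op a b) z ->
    second_kind_fun a b 0 z * characteristic_fun zeta z = weylE a b T z.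
  by move=> hz; rewrite charE; apply: second_kind_fun_charD.
move=> z; rewrite -(weylE_series a_gt0 T_inv J_pos) /regularized_weyl_fun.
case: asboolP => [|nres]; first exact: E_res.
have : spectrum (jacobi_op a b) z by [].
rewrite specE => -[j _ zj].
have [d d0 hd] : exists2 d : R, 0 < d &
    forall k, k != j -> d <= `|zeta k - zeta j|.
  (* The closest points of the spectrum are the two neighbours; the first point has none on the
     left, and any positive number will do. *)
  pose d0 := if j is i.+1 then zeta j - zeta i else 1.
  exists (Num.min d0 (zeta j.+1 - zeta j)).
    rewrite lt_min !subr_gt0 (zeta_homo _ _ (ltnSn j)) andbT /d0.
    by case: (j) => // i; rewrite subr_gt0 zeta_homo.
  have le_zeta m n : (m <= n)%N -> zeta m <= zeta n.
    by rewrite leq_eqVlt => /predU1P[->//|/zeta_homo/ltW].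
  move=> k; rewrite neq_ltn => /orP[kj|jk]; rewrite ge_min; apply/orP; [left|right].
    rewrite distrC ger0_norm ?subr_ge0 ?le_zeta ?(ltnW kj) // /d0.
    by case: (j) kj => // i; rewrite ltnS => ki; rewrite lerD2l lerN2 le_zeta.
  by rewrite ger0_norm ?subr_ge0 ?le_zeta ?(ltnW jk) // lerD2r le_zeta.
(* Within [d] of z every other point is in the resolvent set, where the product is [weylE];
   continuity of [weylE] at z gives the removable value. *)
apply: cvg_lim; first exact: norm_hausdorff.
apply/cvgrPdist_lt => -[e e'] /=; rewrite ltcE /= => /andP[/eqP -> e0].
have [d' d'0 hd'] := weylE_continuous a_gt0 T_inv J_pos trace_le z e0.
apply/nbhs_ballP; exists (Num.min d d')%:C => /=.
  by rewrite ltcR lt_min d0.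
move=> x; rewrite -ball_normE /= distrC normc_cmod ltcR lt_min => /andP[xd xd'] xz.
rewrite E_res; first by rewrite distrC normc_cmod ltcR hd'.
apply: contrapT => xspec; have : spectrum (jacobi_op a b) x by [].
rewrite specE => -[k _ xk]; have [kj|kj] := eqVneq k j.
  by move: xz; rewrite -xk -zj kj eqxx.
by have := hd k kj; rewrite -cmod_real rmorphB /= xk zj leNgt xd.
Qed.
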